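(* Let $q=10$ and let $\alpha$ be real with $9\alpha\notin\mathbb Z$. Put $\epsilon=\varepsilon_q(\alpha)$ and $\xi=\xi_q(\alpha)=\epsilon/14$ (defined in the context). Let $\mu,\nu>0$ be integers satisfying the admissibility condition $$\frac{(4-2\epsilon)\xi}{\epsilon}\le\frac{\mu}{\mu+\nu}\le\frac{1-(6-2\epsilon)\xi}{2-\epsilon}$$ and the strengthened carry range $$\frac{\mu}{\mu+\nu}\ge\frac13-\frac{\xi}{4}.$$ Then for all complex numbers $b_n$ with $|b_n|\le1$, $$\sum_{10^{\mu-1}<m\le10^\mu}\left|\sum_{10^{\nu-1}<n\le10^\nu}b_n\,e(\alpha s(mn))\right|\ \le\ C_{\mathrm{II}}\,(\mu+\nu)\,10^{(1-c_1\|9\alpha\|^2)(\mu+\nu)},$$ where $$C_{\mathrm{II}}:=2\sqrt{10}\,\sqrt{1+10^3\log10+10^8}\ <\ 64000.$$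
   Context: $s(n)$ is the sum of the decimal digits of $n$; $e(t)=e^{2\pi it}$; $\log$ is the natural logarithm; $\|\beta\|$ is the distance from $\beta$ to the nearest integer. With $q=10$: $\omega_q=\left(\frac32-\frac{\log5}{\log3}\right)\frac{\log2}{\log 10}$ and $c_1=\frac1{28}\min\left(4\omega_{q},\frac{\pi^2}{12}\cdot\frac{9}{11\log10}\right)=\omega_{q}/7=0.0015062887\ldots$. Put $\phi_q(t)=\left|\sum_{0\le v<q}e(vt)\right|$; define $\gamma_q(\alpha)$ by $q^{\gamma_q(\alpha)}=\max_{t\in\mathbb R}\sqrt{\phi_q(\alpha+t)\phi_q(\alpha+qt)}$; $\tau_q(\alpha)=\min\left(\omega_q,\,-2\log(\phi_q(\alpha)/q)/\log q\right)$ (with the second entry $+\infty$ if $\phi_q(\alpha)=0$); $\varepsilon_q(\alpha)=\min(\omega_q,\tau_q(\alpha),1-\gamma_q(\alpha))$. *)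

(* Defs.v *)
From HB Require Import structures.
From mathcomp Require Import all_boot all_order all_algebra.
From mathcomp Require Import all_classical all_reals all_analysis.
From mathcomp Require Import complex.

Set Implicit Arguments.
Unset Strict Implicit.
Unset Printing Implicit Defensive.

Import Order.TTheory GRing.Theory Num.Theory.
Import numFieldNormedType.Exports.

Local Open Scope classical_set_scope.
Local Open Scope ring_scope.

(* The digits of n of index i >= n vanish, since n < 10 ^ n. *)
Definition digit_sum (n : nat) : nat :=
  (\sum_(0 <= i < n) (n %/ 10 ^ i) %% 10)%N.

Section Constants.
Variable R : realType.
Implicit Types t x alpha : R.

(* e(t) = exp(2 pi i t) *)
Definition e t : R[i] := (cos (2 * pi * t) +i* sin (2 * pi * t))%C.

(* Real-valued modulus; the norm `|z| of R[i] is valued in R[i]. *)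
Definition cabs (z : R[i]) : R := Normc.normc z.

Definition dist_int x : R := inf [set `|x - k%:~R| | k in [set: int]].

Definition phi t : R := cabs (\sum_(0 <= v < 10) e (v%:R * t)).

Definition omega : R := (3 / 2 - ln 5 / ln 3) * (ln 2 / ln 10).

(* The supremum is a maximum: the function of t is continuous and 1-periodic.
   It is positive, so gamma is the exponent with 10 `^ gamma equal to it. *)
Definition gamma alpha : R :=
  ln (sup [set Num.sqrt (phi (alpha + t) * phi (alpha + 10 * t))
           | t in [set: R]]) / ln 10.

(* The second entry of the minimum is +oo when phi alpha = 0
   (whereas ln 0 = 0 in the library). *)
Definition tau alpha : R :=
  if phi alpha == 0 then omega
  else Num.min omega (- 2 * ln (phi alpha / 10) / ln 10).

Definition eps alpha : R :=
  Num.min omega (Num.min (tau alpha) (1 - gamma alpha)).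

Definition xi alpha : R := eps alpha / 14.

Definition c1 : R :=
  1 / 28 * Num.min (4 * omega) (pi ^+ 2 / 12 * (9 / (11 * ln 10))).

Definition C_II : R :=
  2 * Num.sqrt 10 * Num.sqrt (1 + 10 ^+ 3 * ln 10 + 10 ^+ 8).

End Constants.

Arguments omega {R}.
Arguments c1 {R}.
Arguments C_II {R}.

(* Main.v *)
Require Import Defs.
From HB Require Import structures.
From mathcomp Require Import all_boot all_order all_algebra.
From mathcomp Require Import all_classical all_reals all_analysis.
From mathcomp Require Import complex zify ring lra.

(** The proof follows the method of Mauduit and Rivat for sums of type II.  Put
    [N = mu + nu] and [th = dist_int (9 * alpha)].  From [0 <= eps alpha <= 1 / 91] the
    ratio [mu / N] lies between .333 and [91 / 181], and [c1 <= 1 / 637]; so it suffices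
    to gain [10 ^ (th ^ 2 N / 637)] over the trivial bound ([type_two_savings]).

    Van der Corput's inequality with shifts below [10 ^ rho], where [10 ^ rho] is about
    the square of the gain, leads to correlations of the phases of [m (n + r)] and [m n]
    ([van_der_corput]).  Adding [m r] to [m n] rarely propagates a carry beyond the digit
    of index [l = mu + 2 rho], hence only the [l] lowest digits matter
    ([full_corr_sum_le]).  The digit sum truncated to them is periodic modulo [10 ^ l],
    and its Fourier coefficients have the modulus [dprod l x], a product of values of
    [psi = phi / 10] at [10 ^ i x - alpha].  After Fourier expansion, the sum over [m] is
    a Dirichlet kernel, and summing over [n] averages this kernel over [M] equidistant
    points, where [M] divides [10 ^ l] and is the reduced denominator of the difference
    of the two frequencies.  The average is about [1 / M] times its maximal value.

    If [M] is large, the gain comes from the coefficients.  The Cauchy-Schwarz inequality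
    bounds the sum of [dprod x * dprod (x + j / M)] over all [x] and [j] by [M]
    ([dprod_corr_le] with [k = 0]), which only compensates the factor [1 / M].  The
    inequality is strict by a fixed factor at each digit that the denominator [M]
    involves: among the points [t + b / 10] the one nearest to an integer has a value of
    [psi] that is much larger than that of most others ([psi_gap]).

    If [M] is small, the gain comes from the kernel, unless [M k r] is close to a
    multiple of [10 ^ l], where [k / 10 ^ l] is one of the frequencies
    ([kernel_good_le]).  There are few such [k], and for them [dprod] itself is small:
    [10 (x - alpha) - (10 x - alpha) = - 9 alpha], so of two consecutive arguments of
    [psi] one is at distance at least [th / 11] from the integers ([dprod_le]). *)

Set Implicit Arguments.
Unset Strict Implicit.
Unset Printing Implicit Defensive.

Import Order.TTheory GRing.Theory Num.Theory.
Import numFieldNormedType.Exports.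

Local Open Scope ring_scope.

(** * The exponential and the modulus *)

Arguments e : simpl never.
Arguments cabs : simpl never.
Arguments conjc : simpl never.

Section ComplexModulus.
Variable R : realType.
Implicit Types (z w : R[i]) (t s x : R).

Lemma cabs0 : cabs (0 : R[i]) = 0.
Proof. exact: Normc.normc0. Qed.

Lemma cabsM z w : cabs (z * w) = cabs z * cabs w.
Proof. exact: Normc.normcM. Qed.

Lemma cabsN z : cabs (- z) = cabs z.
Proof. exact: normcN. Qed.

Lemma cabsD z w : cabs (z + w) <= cabs z + cabs w.
Proof. exact: le_normcD. Qed.

Lemma cabsJ z : cabs (conjc z) = cabs z.
Proof. by case: z => a b; rewrite /cabs /conjc /= sqrrN. Qed.

Lemma cabs_ge0 z : 0 <= cabs z.
Proof. by case: z => a b; exact: sqrtr_ge0. Qed.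

Lemma cabs_real x : cabs (x%:C)%C = `|x|.
Proof. by rewrite /cabs /= expr0n addr0 sqrtr_sqr. Qed.

Lemma cabs_sum (I : Type) (r : seq I) (P : pred I) (f : I -> R[i]) :
  cabs (\sum_(i <- r | P i) f i) <= \sum_(i <- r | P i) cabs (f i).
Proof.
elim/big_rec2: _ => [|i y z _ h]; first by rewrite cabs0.
exact: le_trans (cabsD _ _) (lerD (lexx _) h).
Qed.

Lemma conjc_sum (I : Type) (r : seq I) (P : pred I) (f : I -> R[i]) :
  conjc (\sum_(i <- r | P i) f i) = \sum_(i <- r | P i) conjc (f i).
Proof. exact: (@raddf_sum _ _ (@conjc R)). Qed.

Lemma cabs_sqr z : ((cabs z ^+ 2)%:C)%C = z * conjc z.
Proof.
case: z => a b; rewrite /cabs /= sqr_sqrtr ?addr_ge0 ?sqr_ge0 //.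
by rewrite /conjc; apply/eqP; rewrite eq_complex /=; apply/andP; split; apply/eqP; ring.
Qed.

Lemma cabs_sqrE z : cabs z ^+ 2 = complex.Re z ^+ 2 + complex.Im z ^+ 2.
Proof. by case: z => a b; rewrite /cabs /= sqr_sqrtr ?addr_ge0 ?sqr_ge0. Qed.

Lemma eD s t : e (s + t) = e s * e t.
Proof.
rewrite /e mulrDr cosD sinD; apply/eqP; rewrite eq_complex /=.
by apply/andP; split; apply/eqP; ring.
Qed.

Lemma e0 : e (0 : R) = 1.
Proof. by rewrite /e mulr0 cos0 sin0. Qed.

Lemma eN t : e (- t) = conjc (e t).
Proof. by rewrite /e mulrN cosN sinN. Qed.

Lemma cabs_e t : cabs (e t) = 1.
Proof. by rewrite /cabs /e /= cos2Dsin2 sqrtr1. Qed.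

Lemma e1 : e (1 : R) = 1.
Proof. by rewrite /e mulr1 mulr_natl cos2pi sin2pi. Qed.

Lemma e_nat n : e (n%:R : R) = 1.
Proof. by elim: n => [|n ih]; rewrite ?e0 // -natr1 eD ih e1 mulr1. Qed.

Lemma eDnat t n : e (t + n%:R) = e t.
Proof. by rewrite eD e_nat mulr1. Qed.

Lemma eBnat t n : e (t - n%:R) = e t.
Proof. by rewrite -[in RHS](subrK n%:R t) eDnat. Qed.

Lemma eDint t (k : int) : e (t + k%:~R) = e t.
Proof. by case: k => n; [exact: eDnat | rewrite NegzE mulrNz eBnat]. Qed.

Lemma e_mulrn t n : e (n%:R * t) = e t ^+ n.
Proof.
elim: n => [|n ih]; first by rewrite mul0r e0.
by rewrite -natr1 mulrDl mul1r eD ih exprSr.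
Qed.

Lemma cabs_1Be t : cabs (1 - e t) = 2 * `|sin (pi * t)|.
Proof.
have h : cabs (1 - e t) ^+ 2 = (2 * `|sin (pi * t)|) ^+ 2.
  rewrite cabs_sqrE /e /=.
  have -> : 2 * pi * t = (pi * t) *+ 2 by ring.
  rewrite cos_mulr2n sin_mulr2n exprMn real_normK ?num_real //.
  have := cos2Dsin2 (pi * t).
  set c := cos _; set s := sin _ => hcs.
  have -> : c ^+ 2 *+ 2 - 1 = 1 - s ^+ 2 *+ 2 by lra.
  rewrite sub0r sqrrN -[(c * s *+ 2)]mulr_natr !exprMn (_ : c ^+ 2 = 1 - s ^+ 2); last by lra.
  ring.
by apply/eqP; rewrite -(@eqrXn2 _ 2) // ?cabs_ge0 ?h // mulr_ge0.
Qed.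

(** Multiplying the sum by [1 - e t] telescopes it.  The form without a quotient also
    covers the integers [t]. *)
Lemma cabs_geom t n :
  cabs (\sum_(v < n) e (v%:R * t)) * `|sin (pi * t)| = `|sin (pi * (n%:R * t))|.
Proof.
apply: (@mulfI _ 2) => //; rewrite mulrCA -cabs_1Be -[RHS]cabs_1Be e_mulrn.
rewrite mulrC -cabsM -[1 - e t]opprB -[1 - e t ^+ n]opprB mulNr !cabsN subrX1.
by congr (cabs (_ * _)); apply: eq_bigr => v _; rewrite e_mulrn.
Qed.

End ComplexModulus.

(** * Elementary trigonometric estimates *)

Section Trigonometry.
Variable R : realType.
Implicit Types x y t : R.

Lemma le_of_derive_ge0 (f df : R -> R) x :
  (forall y, is_derive y 1 f (df y)) -> (forall y, 0 < y -> 0 <= df y) ->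
  0 <= x -> f 0 <= f x.
Proof.
move=> D df0 x0.
have Df y : derivable f y 1 by have [] := D y.
apply: (@ger0_derive1_ndecr R f 0 x) => // [y|].
  by rewrite in_itv /= => /andP[y0 _]; rewrite derive1E (derive_val (is_derive := D y)) df0.
by apply: derivable_within_continuous => y _.
Qed.

Lemma sin_le x : 0 <= x -> sin x <= x.
Proof.
move=> x0; rewrite -subr_ge0.
have := @le_of_derive_ge0 (fun z => z - sin z) (fun z => 1 - cos z) x.
by rewrite sin0 subrr; apply=> // y _; rewrite subr_ge0 cos_le1.
Qed.

Lemma cos_halfE x : cos x = 1 - 2 * sin (x / 2) ^+ 2.
Proof.
rewrite [in LHS](_ : x = (x / 2) *+ 2) ?cos_mulr2n ?cos2sin2; last first.
  by rewrite -mulr_natr mulfVK.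
by rewrite -mulr_natr; ring.
Qed.

Lemma cos_ge x : 0 <= x -> 1 - x ^+ 2 / 2 <= cos x.
Proof.
move=> x0; rewrite cos_halfE lerD2l lerN2.
have h : `|sin (x / 2)| <= x / 2.
  have [s0|s0] := ger0P (sin (x / 2)); first by rewrite sin_le // divr_ge0.
  have x2 : 0 <= x / 2 by rewrite divr_ge0.
  have [//|x1] := leP (- sin (x / 2)) (x / 2).
  have := sin_geN1 (x / 2) => sN.
  have : 0 < sin (x / 2).
    apply: sin_gt0_pihalf; rewrite lt_neqAle x2 andbT; apply/andP; split.
      by apply/eqP => E; move: s0; rewrite -E sin0 ltxx.
    by apply: lt_le_trans (pihalf_ge1 R); lra.
  by rewrite ltNge ltW.
have : sin (x / 2) ^+ 2 <= (x / 2) ^+ 2.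
  by rewrite -real_normK ?num_real // lerXn2r // nnegrE ?divr_ge0.
by nra.
Qed.

Lemma sin_ge x : 0 <= x -> x - x ^+ 3 / 6 <= sin x.
Proof.
move=> x0; rewrite -subr_ge0.
have := @le_of_derive_ge0 (fun z => sin z - (z - z ^+ 3 / 6))
  (fun z => cos z - (1 - z ^+ 2 / 2)) x.
rewrite sin0 expr0n /= mul0r !subrr; apply=> // y.
  by apply: is_derive_eq; rewrite /GRing.scale /=; lra.
by move=> y0; rewrite subr_ge0 cos_ge // ltW.
Qed.

(** The sign of the cosine at 8/5 tells on which side of it the zero [pi / 2] lies. *)
Lemma pi_lt : pi < 16 / 5 :> R.
Proof.
have h : cos (8 / 5 : R) < 0.
  rewrite cos_halfE.
  have := @sin_ge (8 / 5 / 2) ltac:(by []).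
  set s := sin _ => hs.
  have : (5 / 7 <= s) by apply: le_trans hs; lra.
  by move=> ?; nra.
rewrite ltNge; apply/negP => P.
have : 0 <= cos (8 / 5 : R) by apply: cos_ge0_pihalf; lra.
by rewrite leNgt h.
Qed.

(** Likewise with 3/2, where two doublings of the angle 3/8 give the sign. *)
Lemma pi_gt3 : 3 < pi :> R.
Proof.
have h : 0 < cos (3 / 2 : R).
  have -> : (3 / 2 : R) = (3 / 8 *+ 2) *+ 2 by field.
  rewrite !cos_mulr2n.
  have := @cos_ge (3 / 8) ltac:(by []).
  have := cos_le1 (3 / 8 : R).
  set c := cos _ => c1 c2.
  have : 119 / 128 <= c by apply: le_trans c2; lra.
  move=> c3; have : (119/128)^+2 <= c ^+ 2 by rewrite lerXn2r // nnegrE; lra.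
  have : c ^+ 2 <= 1 by rewrite exprn_ile1 //; lra.
  set d := c ^+ 2; rewrite -[d *+ 2]mulr_natr -[X in 0 < X - 1]mulr_natr; nra.
rewrite ltNge; apply/negP => P.
have : cos (3 / 2 : R) <= 0.
  rewrite -(cos_pihalf R).
  have [->|E] := eqVneq (3 / 2 : R) (pi / 2); first by [].
  by rewrite ltW // ltr_cos ?in_itv /= ?lt_neqAle; have := pi_ge2 R; have := pihalf_lt2 R; lra.
by rewrite leNgt h.
Qed.

(** Jordan's inequality: by the mean value theorem the mean slopes of the sine before
    and after [pi x] are values of the cosine, which decreases. *)
Lemma jordan x : 0 <= x <= 1 / 2 -> 2 * x <= sin (pi * x).
Proof.
move=> /andP[x0 x1]; have P := pi_gt0 R; have P3 := pi_gt3.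
have [->|xn0] := eqVneq x 0; first by rewrite !mulr0 sin0.
have [->|xn1] := eqVneq x (1 / 2).
  by rewrite (_ : pi * (1 / 2) = pi / 2) ?sin_pihalf; lra.
have {xn0}x0 : 0 < x by rewrite lt_neqAle eq_sym xn0.
have {xn1}x1 : x < 1 / 2 by rewrite lt_neqAle xn1.
have xp : 0 < pi * x by rewrite mulr_gt0.
have xq : pi * x < pi / 2 by nra.
have cS (a b : R) : {within `[a, b], continuous (@sin R)}%classic.
  by apply: continuous_subspaceT => ?; exact: continuous_sin.
have [c /[!in_itv]/= /andP[c0 c1]] := @MVT R sin cos 0 (pi * x) xp (fun x _ => is_derive_sin x) (cS _ _).
rewrite sin0 !subr0 => Ec.
have [d /[!in_itv]/= /andP[d0 d1]] := @MVT R sin cos (pi * x) (pi / 2) xq (fun x _ => is_derive_sin x) (cS _ _).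
rewrite sin_pihalf => Ed.
have : cos d < cos c by rewrite ltr_cos ?in_itv /=; lra.
have cc : 0 < cos c by apply: cos_gt0_pihalf; lra.
move: Ec Ed; set s := sin _ => Ec Ed dc.
rewrite -(ler_pM2r (x := pi)) //.
have : 1 - s <= cos c * (pi / 2 - pi * x).
  by rewrite Ed; apply: ler_wpM2r; lra.
have -> : cos c = s / (pi * x) by rewrite Ec mulfK ?gt_eqF.
rewrite mulrAC ler_pdivlMr //; nra.
Qed.

Lemma jordan_norm t : `|t| <= 1 / 2 -> 2 * `|t| <= `|sin (pi * t)|.
Proof.
move=> t1; have := @jordan `|t|; rewrite normr_ge0 t1 => /(_ isT).
suff -> : `|sin (pi * t)| = `|sin (pi * `|t|)| by move=> /le_trans; apply; exact: ler_norm.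
by have [//|_] := ger0P t; rewrite mulrN sinN normrN.
Qed.

Lemma norm_sin_le x : `|sin x| <= `|x|.
Proof.
suff h y : 0 <= y -> `|sin y| <= y.
  have [x0|x0] := ger0P x; first exact: h.
  by rewrite -normrN -sinN h // oppr_ge0 ltW.
move=> hy; rewrite ler_norml sin_le // andbT lerNl.
have [y1|y1] := leP 1 y; first by apply: le_trans y1; rewrite lerNl sin_geN1.
by rewrite (le_trans _ hy) // oppr_le0 sin_ge0_pi // hy /=; have := pi_gt3; lra.
Qed.

End Trigonometry.

(** * Orthogonality of the additive characters *)

Section Orthogonality.
Variable R : realType.
Implicit Types s t x : R.

Lemma e_neq1 (n d : nat) : (0 < d < n)%N -> e (d%:R / n%:R : R) != 1.
Proof.
move=> /andP[d0 dn]; have n0 : (0 < n)%N by lia.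
apply/eqP => E; have := cabs_1Be (d%:R / n%:R : R).
rewrite E subrr cabs0 => /esym/eqP; rewrite mulf_eq0 pnatr_eq0 /= normr_eq0 gt_eqF //.
apply: sin_gt0_pi; rewrite mulr_gt0 ?pi_gt0 ?divr_gt0 ?ltr0n //=.
by rewrite gtr_pMr ?pi_gt0 // ltr_pdivrMr ?ltr0n // mul1r ltr_nat.
Qed.

Lemma sum_e (n d : nat) : (d < n)%N ->
  \sum_(h < n) e (h%:R * (d%:R / n%:R) : R) = if d == 0%N then n%:R else 0.
Proof.
move=> dn; have n0 : (n%:R : R) != 0 by rewrite pnatr_eq0; lia.
case: eqP => [->|d0].
  by under eq_bigr do rewrite mul0r mulr0 e0; rewrite sumr_const card_ord.
have z1 := @e_neq1 n d ltac:(lia).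
under eq_bigr do rewrite e_mulrn.
apply: (mulfI (x := e (d%:R / n%:R) - 1)); first by rewrite subr_eq0.
by rewrite -subrX1 -e_mulrn mulrC divfK // e_nat subrr mulr0.
Qed.

Lemma orthogonality (n u v : nat) : (u < n)%N -> (v < n)%N ->
  \sum_(h < n) e (h%:R * ((u%:R - v%:R) / n%:R) : R) = if u == v then n%:R else 0.
Proof.
have wlog_le (a b : nat) : (b <= a)%N -> (a < n)%N ->
    \sum_(h < n) e (h%:R * ((a%:R - b%:R) / n%:R) : R) = if a == b then n%:R else 0.
  by move=> ba an; rewrite -natrB // sum_e ?subn_eq0 ?eqn_leq ?ba ?andbT //; lia.
move=> un vn; have [vu|/ltnW uv] := leqP v u; first exact: wlog_le.
have := wlog_le v u uv vn; rewrite eq_sym => /(congr1 conjc).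
rewrite conjc_sum (fun_if conjc) conjc_nat conjc0 => <-.
by apply: eq_bigr => h _; rewrite -eN -mulrN -mulNr opprB.
Qed.

End Orthogonality.

(** * The normalised digit kernel *)

Section Kernel.
Variable R : realType.
Implicit Types s t x : R.

Definition psi t : R := phi t / 10.

Lemma phiE t : phi t = cabs (\sum_(v < 10) e (v%:R * t)).
Proof. by rewrite /phi big_mkord. Qed.

Lemma psi_ge0 t : 0 <= psi t.
Proof. by rewrite divr_ge0 ?cabs_ge0. Qed.

Lemma phi_le10 t : phi t <= 10.
Proof.
rewrite phiE (le_trans (cabs_sum _ _ _)) //.
by under eq_bigr do rewrite cabs_e; rewrite sumr_const card_ord.
Qed.

Lemma psi_le1 t : psi t <= 1.
Proof. by rewrite ler_pdivrMr // mul1r phi_le10. Qed.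

Lemma psiDint t (k : int) : psi (t + k%:~R) = psi t.
Proof.
rewrite /psi !phiE; congr (cabs _ / _); apply: eq_bigr => v _.
by rewrite mulrDr -[v%:R * k%:~R]/(v%:~R * k%:~R) -intrM eDint.
Qed.

Lemma psiDnat t n : psi (t + n%:R) = psi t.
Proof. exact: (psiDint t n). Qed.

Lemma psi_sin t : 10 * psi t * `|sin (pi * t)| = `|sin (pi * (10 * t))|.
Proof. by rewrite -cabs_geom -phiE mulrCA divff ?mulr1. Qed.

Lemma psi_le t : `|t| <= 1 / 2 -> psi t * (20 * `|t|) <= 1.
Proof.
move=> t1; have := sin_max (pi * (10 * t)); rewrite -psi_sin; apply: le_trans.
have := jordan_norm t1; have := psi_ge0 t; nra.
Qed.

(** Jordan's inequality gives the lower bound [2 / pi], and [pi < 16 / 5]. *)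
Lemma psi_ge_near t : `|t| <= 1 / 20 -> 5 / 8 <= psi t.
Proof.
move=> t1; have [->|t0] := eqVneq t 0.
  rewrite /psi phiE; under eq_bigr do rewrite mulr0 e0.
  rewrite sumr_const card_ord -[1 *+ 10]/(10%:R) -(rmorph_nat (real_complex R)) cabs_real.
  by rewrite ger0_norm //; lra.
have P := pi_gt0 R; have P2 := pi_lt R.
have tp : 0 < `|t| by rewrite normr_gt0.
have := psi_sin t; have : `|10 * t| <= 1 / 2 by rewrite normrM ger0_norm; lra.
move=> /jordan_norm h E; move: h; rewrite -E normrM ger0_norm //.
have := norm_sin_le (pi * t); rewrite normrM (gtr0_norm P).
have := psi_ge0 t; move: (psi t) (`|sin _|) => p s p0 h1 h2.
have h3 : 2 * `|t| <= p * (pi * `|t|).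
  have : p * s <= p * (pi * `|t|) by rewrite ler_wpM2l.
  lra.
rewrite mulrA ler_pM2r // in h3; nra.
Qed.

(** Pairing the terms [v] and [v + 5] splits off the factor [1 + e (5 t)]. *)
Lemma psi_le_cos t : psi t <= `|cos (5 * pi * t)|.
Proof.
rewrite ler_pdivrMr // phiE.
have -> : \sum_(v < 10) e (v%:R * t) = (1 - e (5 * t + 1 / 2)) * \sum_(v < 5) e (v%:R * t).
  have -> : e (5 * t + 1 / 2) = - e (5 * t).
    rewrite eD [e (1 / 2)](_ : _ = -1) ?mulrN1 // /e.
    have -> : 2 * pi * (1 / 2) = pi :> R by field.
    by rewrite cospi sinpi; apply/eqP; rewrite eq_complex /= oppr0 !eqxx.
  rewrite opprK mulrDl mul1r mulr_sumr (@big_split_ord _ _ _ 5 5) /=; congr (_ + _).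
  by apply: eq_bigr => i _; rewrite -eD natrD mulrDl.
rewrite cabsM cabs_1Be mulrC.
have -> : pi * (5 * t + 1 / 2) = 5 * pi * t + pi / 2 by field.
rewrite sinDpihalf.
have : cabs (\sum_(v < 5) e (v%:R * t)) <= 5.
  rewrite (le_trans (cabs_sum _ _ _)) //.
  by under eq_bigr do rewrite cabs_e; rewrite sumr_const card_ord.
by have := normr_ge0 (cos (5 * pi * t)); nra.
Qed.

(** A point at distance at least [th / 11] from the integers keeps [psi] away
    from 1.  Up to 1/10 this comes from the factor [|cos (5 pi t)|], further away from
    the bound [1 / (20 |t|)]. *)
Lemma psi_le_far t th : 0 <= th <= 1 / 2 -> th / 11 <= `|t| -> `|t| <= 1 / 2 ->
  psi t <= 1 - 4 / 5 * th ^+ 2.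
Proof.
move=> /andP[h0 h1] tt t2.
have [t1|t1] := leP `|t| (1 / 10); last first.
  have := psi_le t2; have := psi_ge0 t; nra.
have P := pi_gt0 R; have P2 := pi_lt R; have P3 := pi_gt3 R.
apply: le_trans (psi_le_cos t) _.
have -> : `|cos (5 * pi * t)| = cos (5 * pi * `|t|).
  rewrite -[in LHS]cos_norm normrM (gtr0_norm (_ : 0 < 5 * pi)) ?mulr_gt0 //.
  by apply: ger0_norm; apply: cos_ge0_pihalf; have := normr_ge0 t; nra.
have : cos (5 * pi * `|t|) <= cos (5 * pi * (th / 11)).
  have [->//|E] := eqVneq (th / 11) `|t|.
  by rewrite ltW // ltr_cos ?in_itv /= ?ltr_pM2l ?lt_neqAle ?E //; nra.
move=> /le_trans; apply; rewrite cos_halfE lerD2l lerN2.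
set y := _ / 2; have y0 : 15 / 22 * th <= y by rewrite /y; nra.
have y1 : y <= 4 / 11 by rewrite /y; nra.
have := @sin_ge R y ltac:(lra).
have : 1 / 6 * y ^+ 2 <= 1 / 40 by nra.
move: (sin y) => s a b.
have : 39 / 40 * y <= s by apply: le_trans b; rewrite exprSr; nra.
move=> c; have : 13 / 20 * th <= s by lra.
by move=> d; have : (13 / 20 * th) ^+ 2 <= s ^+ 2; [rewrite lerXn2r // nnegrE; lra|nra].
Qed.

(** Expanding the squares, the sum over [b] keeps only the diagonal terms. *)
Lemma parseval n s : (0 < n)%N ->
  \sum_(b < n) cabs (\sum_(v < n) e (v%:R * (s + b%:R / n%:R))) ^+ 2 = n%:R ^+ 2.
Proof.
move=> n0; have nn : (n%:R : R) != 0 by rewrite pnatr_eq0 -lt0n.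
apply: complexI; rewrite rmorph_sum /=.
have E (b : 'I_n) : ((cabs (\sum_(v < n) e (v%:R * (s + b%:R / n%:R))) ^+ 2)%:C)%C =
    \sum_(u < n) \sum_(v < n)
      e ((u%:R - v%:R) * s) * e (b%:R * ((u%:R - v%:R) / n%:R)).
  rewrite cabs_sqr conjc_sum mulr_suml; apply: eq_bigr => u _.
  rewrite mulr_sumr; apply: eq_bigr => v _.
  by rewrite -eN -!eD; congr e; field.
rewrite (eq_bigr _ (fun b _ => E b)) exchange_big /=.
transitivity (\sum_(u < n) (n%:R : R[i])).
  apply: eq_bigr => u _; rewrite exchange_big /= (bigD1 u) //= [X in _ + X]big1 => [|v vu].
    by rewrite -mulr_sumr orthogonality // eqxx subrr mul0r e0 mul1r addr0.
  rewrite -mulr_sumr orthogonality // eq_sym.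
  by rewrite -[nat_of_ord v == u]/(v == u) (negPf vu) mulr0.
by rewrite sumr_const card_ord /= rmorphXn /= rmorph_nat expr2 mulr_natr.
Qed.

Lemma psi_parseval s : \sum_(b < 10) psi (s + b%:R / 10) ^+ 2 = 1.
Proof.
apply: (mulIf (x := 10 ^+ 2)); first by rewrite expf_neq0.
rewrite mul1r mulr_suml -[RHS](@parseval 10 s isT); apply: eq_bigr => b _.
by rewrite -phiE -exprMn divfK.
Qed.

End Kernel.

(** * Sums of periodic functions *)

Section PeriodicSums.
Variable R : numDomainType.
Implicit Types f : nat -> R.

Definition periodic_mod (M : nat) f := forall j, f (j + M)%N = f j.

Lemma periodic_modn M f j : periodic_mod M f -> f (j %% M)%N = f j.
Proof.
move=> pf; rewrite [in RHS](divn_eq j M) addnC.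
by elim: (j %/ M)%N => [|k ih]; rewrite ?mul0n ?addn0 // mulSnr addnA pf.
Qed.

(** Multiplication by [u] permutes the residues modulo [M]. *)
Lemma sum_coprime M u f : (0 < M)%N -> coprime u M -> periodic_mod M f ->
  \sum_(j < M) f (u * j)%N = \sum_(j < M) f j.
Proof.
case: M => // M _ uM pf.
pose h (j : 'I_M.+1) : 'I_M.+1 := inord ((u * j) %% M.+1).
have hE j : h j = ((u * j) %% M.+1)%N :> nat by rewrite inordK // ltn_mod.
have hI : injective h.
  move=> i j /(congr1 (@nat_of_ord _)); rewrite !hE => /eqP E; apply/val_inj/eqP => /=.
  wlog ij : i j E / (j <= i)%N.
    by move=> W; have [|/ltnW] := leqP j i; [|rewrite eq_sym; rewrite eq_sym in E]; exact: W.
  move: E; rewrite eqn_mod_dvd ?leq_mul2l ?ij ?orbT // -mulnBr Gauss_dvdr 1?coprime_sym //.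
  by move=> /dvdnP[[|k]]; have := ltn_ord i; lia.
rewrite [RHS](reindex_inj hI); apply: eq_bigr => j _.
by rewrite hE periodic_modn.
Qed.

Lemma sum_shift M s f : (0 < M)%N -> periodic_mod M f ->
  \sum_(j < M) f (s + j)%N = \sum_(j < M) f j.
Proof.
case: M => // M _ pf; elim: s => [|s <-]; first by apply: eq_bigr => j _; rewrite add0n.
rewrite big_ord_recr big_ord_recl /= addn0 addrC; congr (_ + _).
  by rewrite addSnnS pf.
by apply: eq_bigr => i _; rewrite /bump addSnnS add1n.
Qed.

Lemma sum_blocks_le L M f s : (0 < M)%N -> periodic_mod M f -> (forall j, 0 <= f j) ->
  \sum_(n < L) f (s + n)%N <= (L %/ M).+1%:R * \sum_(j < M) f j.
Proof.
move=> M0 pf f0; elim: (L %/ M)%N {-2}L s (leqnn (L %/ M)) => [|k ih] {}L s.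
  rewrite leqn0 -leqn0 -ltnS ltn_divLR ?mul1n // => LM.
  rewrite (divn_small LM) mul1r -(sum_shift s M0 pf) -!(big_mkord xpredT (fun j => f (s + j)%N)).
  rewrite [leRHS](big_cat_nat (n := L)) ?(ltnW LM) //= lerDl.
  exact: sumr_ge0.
move=> Lk; have [LM|ML] := ltnP L M.
  apply: le_trans (ih L s _) _; first by rewrite divn_small.
  by rewrite ler_wpM2r ?sumr_ge0 // ler_nat.
rewrite -(big_mkord xpredT (fun j => f (s + j)%N)) (big_cat_nat (n := M)) //=.
rewrite -{1}[M]add0n -[X in _ + X]/(\sum_(M <= j < L) _).
have E : (L %/ M = ((L - M) %/ M).+1)%N.
  by rewrite -[L in LHS](subnK ML) divnDr // divnn M0 addn1.
rewrite {}E in Lk *; rewrite -[X in X%:R * _]addn1 natrD mulrDl mul1r addrC lerD //; last first.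
  by rewrite add0n big_mkord sum_shift.
rewrite -[M in X in X <= _]add0n big_addn big_mkord.
have -> : \sum_(i < L - M) f (s + (i + M))%N = \sum_(i < L - M) f (s + M + i)%N.
  by apply: eq_bigr => j _; rewrite addnAC addnA.
exact: ih.
Qed.

Lemma sum_radix (V : nmodType) (M g : nat) (f : nat -> V) :
  \sum_(j < M * g) f j = \sum_(j < M) \sum_(i < g) f (j + M * i)%N.
Proof.
rewrite exchange_big /= -(big_mkord xpredT f) mulnC big_nat_mul big_mkord.
apply: eq_bigr => i _; rewrite -{1}[(i * M)%N]add0n big_addn mulSn addnK big_mkord.
by apply: eq_bigr => j _; rewrite mulnC.
Qed.

End PeriodicSums.

(** * A gap in the Cauchy-Schwarz inequality for psi *)

Section SpectralGap.
Variable R : realType.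
Implicit Types s t x y alpha : R.

(** Lagrange's identity: the defect is half the sum of all the [(a i - a j) ^ 2]. *)
Lemma sqr_sum_le (n : nat) (a : 'I_n -> R) :
  (\sum_i a i) ^+ 2 <= n%:R * \sum_i a i ^+ 2.
Proof.
have h : 0 <= \sum_i \sum_j (a i - a j) ^+ 2.
  by apply: sumr_ge0 => i _; apply: sumr_ge0 => j _; exact: sqr_ge0.
have E : \sum_i \sum_j (a i - a j) ^+ 2 =
    2 * (n%:R * \sum_i a i ^+ 2 - (\sum_i a i) ^+ 2).
  transitivity (\sum_i (n%:R * a i ^+ 2 - 2 * (a i * \sum_j a j) + \sum_j a j ^+ 2)).
    apply: eq_bigr => i _; rewrite mulr_sumr mulr_sumr -sumrN.
    rewrite -[n in n%:R]card_ord mulr_natl -sumr_const -!big_split /=.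
    by apply: eq_bigr => j _; ring.
  rewrite !big_split /= sumrN -!mulr_sumr -mulr_suml sumr_const card_ord.
  by rewrite -mulr_natl; ring.
by move: h; rewrite E pmulr_rge0 // subr_ge0.
Qed.

(** A sharpening of Cauchy-Schwarz: the defect is the sum of the squares of all the
    differences, of which those with one fixed entry are kept. *)
Lemma sqr_sum_le_var (n : nat) (a : 'I_n -> R) (c : R) (o : 'I_n) : a o = c ->
  (\sum_i a i) ^+ 2 <= n%:R * \sum_i a i ^+ 2 - \sum_i (c - a i) ^+ 2.
Proof.
case: n a o => [|n] a o ao; first by case: o ao.
pose d i := a (lift o i) - c.
have S1 : \sum_i a i = n.+1%:R * c + \sum_i d i.
  rewrite (bigD1_ord o) //= ao sumrB sumr_const card_ord -natr1 mulrDl mul1r.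
  by rewrite -mulr_natl; ring.
have S2' : \sum_i a (lift o i) ^+ 2 = n%:R * c ^+ 2 + 2 * c * \sum_i d i + \sum_i d i ^+ 2.
  rewrite -[n in n%:R]card_ord mulr_natl -sumr_const mulr_sumr -!big_split /=.
  by apply: eq_bigr => i _; rewrite /d; ring.
have S2 : \sum_i a i ^+ 2 = n.+1%:R * c ^+ 2 + 2 * c * \sum_i d i + \sum_i d i ^+ 2.
  by rewrite (bigD1_ord o) //= ao S2' -natr1; ring.
have S3 : \sum_i (c - a i) ^+ 2 = \sum_i d i ^+ 2.
  rewrite (bigD1_ord o) //= ao subrr expr0n add0r.
  by apply: eq_bigr => i _; rewrite /d -sqrrN opprB.
have := sqr_sum_le d; rewrite S1 S2 S3.
move: (\sum_i d i) (\sum_i d i ^+ 2) => u v h.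
rewrite -natr1 in S1 *; move: (n%:R : R) h => m h; lra.
Qed.

(** For [b] in a fixed coset of the subgroup [m Z / (m g) Z], the inner sum runs over
    that same coset. *)
Lemma coset_sum (g m : nat) (u v : nat -> R) : (0 < g)%N ->
  periodic_mod (m * g) u -> periodic_mod (m * g) v ->
  \sum_(b < m * g) \sum_(i < g) u b * v (b + m * i)%N =
  \sum_(c < m) (\sum_(i < g) u (c + m * i)%N) * (\sum_(i < g) v (c + m * i)%N).
Proof.
move=> g0 pu pv; rewrite (sum_radix _ _ (fun b => \sum_(i < g) u b * v (b + m * i)%N)).
apply: eq_bigr => c _; rewrite mulr_suml; apply: eq_bigr => i _.
rewrite -mulr_sumr -(@sum_shift _ g i (fun j => v (c + m * j)%N)) //.
  by congr (_ * _); apply: eq_bigr => j _; rewrite mulnDr addnA.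
by move=> j; rewrite mulnDr addnA pv.
Qed.

Lemma psiN t : psi (- t) = psi t.
Proof.
rewrite /psi !phiE; congr (_ / _); rewrite -cabsJ conjc_sum.
by congr cabs; apply: eq_bigr => v _; rewrite -eN mulrN opprK.
Qed.

Definition psi10 s (b : nat) : R := psi (s + b%:R / 10).

Lemma psi10_periodic s : periodic_mod 10 (psi10 s).
Proof. by move=> j; rewrite /psi10 natrD mulrDl divff // addrA (psiDnat _ 1). Qed.

Lemma psi10_far t (b : nat) (c : R) : `|t| <= 1 / 20 -> (b <= 10)%N ->
  0 < c -> c + 1 <= 2 * b%:R -> c + 1 <= 2 * (10 - b%:R) -> psi10 t b <= c^-1.
Proof.
move=> t1 b10 c0 cb cb'; rewrite -[leRHS]mul1r ler_pdivlMr //.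
rewrite ler_norml in t1; case/andP: t1 => t1 t2.
have p0 : 0 <= psi10 t b by exact: psi_ge0.
have [bs|bl] := leP (t + b%:R / 10) (1 / 2).
  have := @psi_le R (t + b%:R / 10); rewrite -/(psi10 t b).
  have P : 0 <= t + b%:R / 10 by lra.
  rewrite ger0_norm // => /(_ bs); nra.
have := @psi_le R (t + b%:R / 10 - 1); rewrite -/(psi10 t b).
have -> : psi (t + b%:R / 10 - 1) = psi10 t b.
  by rewrite /psi10 -[in RHS](subrK 1 (t + _)) (psiDnat _ 1).
have P : t + b%:R / 10 - 1 <= 0 by lra.
rewrite ler0_norm // => /(_ ltac:(lra)); nra.
Qed.

(** Rotating the grid moves the point that is nearest to an integer to the index 0. *)
Lemma near_grid s : exists t (c : nat), `|t| <= 1 / 20 /\ forall b, psi10 s b = psi10 t (c + b).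
Proof.
pose z := Num.floor (10 * s + 1 / 2).
have /andP[z1 z2] := floor_itv (10 * s + 1 / 2).
exists (s - z%:~R / 10), `|(z %% 10)%Z|%N; split.
  by rewrite intrD in z2; rewrite ler_norml; apply/andP; split; rewrite -/z in z1 z2; lra.
move=> b; rewrite /psi10.
have : z%:~R = (z %/ 10)%Z%:~R * 10 + `|(z %% 10)%Z|%N%:R :> R.
  rewrite {1}(divz_eq z 10) intrD intrM; congr (_ + _).
  by rewrite -[RHS]/(`|(z %% 10)%Z|%N%:Z%:~R) gez0_abs // modz_ge0.
move=> Ez; rewrite natrD.
have -> : s - z%:~R / 10 + (`|(z %% 10)%Z|%N%:R + b%:R) / 10 =
    s + b%:R / 10 - (z %/ 10)%Z%:~R by rewrite Ez; field.
by rewrite -mulrNz psiDint.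
Qed.

(** The averages of [psi] over the cosets of a nontrivial subgroup of [Z/10] lose a
    factor 1.14 against the trivial bound: the point of the grid that is nearest to
    an integer carries a large value of [psi], the others small ones, so that no
    equality can hold in Cauchy-Schwarz. *)
Lemma psi_gap (g m : nat) s s' : (m * g = 10)%N -> (1 < g)%N ->
  57 / 50 * \sum_(b < 10) \sum_(i < g) psi10 s b * psi10 s' (b + m * i) <= g%:R.
Proof.
move=> mg g1; have g0 : (0 < g)%N by lia.
have diag t : 57 / 50 * \sum_(c < m) (\sum_(i < g) psi10 t (c + m * i)) ^+ 2 <= g%:R.
  have [t' [c [t1 E]]] := near_grid t.
  have -> : \sum_(c < m) (\sum_(i < g) psi10 t (c + m * i)) ^+ 2 =
      \sum_(c < m) (\sum_(i < g) psi10 t' (c + m * i)) ^+ 2.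
    have pp r : periodic_mod (m * g) (psi10 r) by rewrite mg; exact: psi10_periodic.
    under eq_bigr do rewrite expr2; under [RHS]eq_bigr do rewrite expr2.
    rewrite -!coset_sum // mg.
    rewrite -[RHS](@sum_shift _ 10 c (fun b => \sum_(i < g) psi10 t' b * psi10 t' (b + m * i))) //.
      by apply: eq_bigr => b _; apply: eq_bigr => i _; rewrite !E addnA.
    by move=> j; apply: eq_bigr => i _; rewrite addnAC !psi10_periodic.
  have m0 : (0 < m)%N by case: m mg.
  have P : \sum_(c < m) \sum_(i < g) psi10 t' (c + m * i) ^+ 2 = 1.
    by rewrite -(sum_radix m g (fun b => psi10 t' b ^+ 2)) mg -(psi_parseval t').
  have near : 5 / 8 <= psi10 t' 0 by rewrite /psi10 mul0r addr0 psi_ge_near.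
  have B : \sum_(c < m) (\sum_(i < g) psi10 t' (c + m * i)) ^+ 2 <=
      g%:R - \sum_(i < g) (psi10 t' 0 - psi10 t' (m * i)) ^+ 2.
    case: m m0 mg P {E} => // m _ mg P.
    apply: (@le_trans _ _ (g%:R * (\sum_(c < m.+1) \sum_(i < g) psi10 t' (c + m.+1 * i) ^+ 2)
      - \sum_(i < g) (psi10 t' 0 - psi10 t' (m.+1 * i)) ^+ 2)); last by rewrite P mulr1.
    rewrite big_ord_recl [X in g%:R * X]big_ord_recl mulrDr addrAC.
    apply: lerD.
      apply: (@sqr_sum_le_var g (fun i => psi10 t' (m.+1 * i)) _ (Ordinal g0)).
      by rewrite /= muln0.
    by rewrite mulr_sumr; apply: ler_sum => j _; exact: sqr_sum_le.
  (* 7 / 57 = 1 - 50 / 57 is what a gain of 57 / 50 requires. *)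
  suff V : (7 / 57 * g%:R : R) <= \sum_(i < g) (psi10 t' 0 - psi10 t' (m * i)) ^+ 2 by lra.
  (* Except for the two neighbours 1 and 9, every other point of the grid is at
     distance at least 3 / 20 from the integers. *)
  have f2 := @psi10_far t' 2 3 t1 isT ltac:(lra) ltac:(lra) ltac:(lra).
  have f3 := @psi10_far t' 3 5 t1 isT ltac:(lra) ltac:(lra) ltac:(lra).
  have f4 := @psi10_far t' 4 7 t1 isT ltac:(lra) ltac:(lra) ltac:(lra).
  have f5 := @psi10_far t' 5 9 t1 isT ltac:(lra) ltac:(lra) ltac:(lra).
  have f6 := @psi10_far t' 6 7 t1 isT ltac:(lra) ltac:(lra) ltac:(lra).
  have f7 := @psi10_far t' 7 5 t1 isT ltac:(lra) ltac:(lra) ltac:(lra).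
  have f8 := @psi10_far t' 8 3 t1 isT ltac:(lra) ltac:(lra) ltac:(lra).
  have sq (p q r : R) : 5 / 8 <= p -> q <= r -> r <= 5 / 8 -> (5 / 8 - r) ^+ 2 <= (p - q) ^+ 2.
    by move=> a b d; apply: lerXn2r; rewrite ?nnegrE; lra.
  have {f2} := sq _ _ _ near f2 ltac:(lra); have {f3} := sq _ _ _ near f3 ltac:(lra).
  have {f4} := sq _ _ _ near f4 ltac:(lra); have {f5} := sq _ _ _ near f5 ltac:(lra).
  have {f6} := sq _ _ _ near f6 ltac:(lra); have {f7} := sq _ _ _ near f7 ltac:(lra).
  have {f8} := sq _ _ _ near f8 ltac:(lra).
  have := sqr_ge0 (psi10 t' 0 - psi10 t' 1); have := sqr_ge0 (psi10 t' 0 - psi10 t' 9).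
  have gm : (g = 2 /\ m = 5 \/ g = 5 /\ m = 2 \/ g = 10 /\ m = 1)%N.
    move: mg g1; clear; do 11 (case: m => [|m]; first by lia); nia.
  have [[-> ->]|[[-> ->]|[-> ->]]] := gm; rewrite !big_ord_recl big_ord0 /= ?muln0 ?mul1n ?subrr;
    rewrite /bump /=; lra.
have pp r : periodic_mod (m * g) (psi10 r) by rewrite mg; exact: psi10_periodic.
have -> : \sum_(b < 10) \sum_(i < g) psi10 s b * psi10 s' (b + m * i) =
    \sum_(c < m) (\sum_(i < g) psi10 s (c + m * i)) * (\sum_(i < g) psi10 s' (c + m * i)).
  by rewrite -coset_sum // mg.
have : \sum_(c < m) (\sum_(i < g) psi10 s (c + m * i)) * (\sum_(i < g) psi10 s' (c + m * i)) <=
    2^-1 * (\sum_(c < m) (\sum_(i < g) psi10 s (c + m * i)) ^+ 2 +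
            \sum_(c < m) (\sum_(i < g) psi10 s' (c + m * i)) ^+ 2).
  rewrite -big_split /= mulr_sumr; apply: ler_sum => c _.
  by have := sqr_ge0 (\sum_(i < g) psi10 s (c + m * i) - \sum_(i < g) psi10 s' (c + m * i)); nra.
have := diag s; have := diag s'; lra.
Qed.

Lemma psi_corr_le1 s s' : \sum_(b < 10) psi10 s b * psi10 s' b <= 1.
Proof.
have : \sum_(b < 10) psi10 s b * psi10 s' b <=
    \sum_(b < 10) (psi10 s b ^+ 2 / 2 + psi10 s' b ^+ 2 / 2).
  by apply: ler_sum => b _; have := sqr_ge0 (psi10 s b - psi10 s' b); nra.
by rewrite big_split /= -!mulr_suml !psi_parseval; lra.
Qed.

End SpectralGap.

(** * Correlations of the digit products *)

Section Correlation.
Variables (R : realType) (alpha : R).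
Implicit Types s t x y : R.

(** The modulus of the Fourier coefficient of the truncated digit sum, see
    [cabs_dhat]. *)
Definition dprod (l : nat) x : R := \prod_(i < l) psi (10 ^+ i * x - alpha).

Lemma dprodS l x : dprod l.+1 x = psi (x - alpha) * dprod l (10 * x).
Proof.
rewrite /dprod big_ord_recl expr0 mul1r; congr (_ * _).
by apply: eq_bigr => i _; rewrite exprSr mulrA.
Qed.

Lemma dprod_ge0 l x : 0 <= dprod l x.
Proof. by apply: prodr_ge0 => i _; exact: psi_ge0. Qed.

Lemma dprodDnat l x (n : nat) : dprod l (x + n%:R) = dprod l x.
Proof.
apply: eq_bigr => i _; rewrite mulrDr -natrX -natrM addrAC; exact: psiDnat.
Qed.

Lemma gcd10_cases (M l : nat) : (M %| 10 ^ l)%N ->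
  let g := gcdn M 10 in
  [/\ (0 < g)%N, (10 %/ g * g = 10)%N, (M %/ g * g = M)%N,
      coprime (10 %/ g) (M %/ g) & (M == 1)%N = ~~ (1 < g)%N].
Proof.
move=> Ml g; have M0 : (0 < M)%N by rewrite (dvdn_gt0 _ Ml) // expn_gt0.
have g0 : (0 < g)%N by rewrite gcdn_gt0 M0.
split => //; [by rewrite divnK // dvdn_gcdr | by rewrite divnK // dvdn_gcdl | |].
  by rewrite coprime_sym /coprime -(eqn_pmul2r g0) mul1n muln_gcdl !divnK ?dvdn_gcdl ?dvdn_gcdr.
apply/idP/idP => [/eqP E|g1]; first by rewrite /g E gcd1n.
have : coprime M (10 ^ l) by rewrite coprimeXr // /coprime -/g; apply/eqP; lia.
by move=> /eqP h; have : (M %| gcdn M (10 ^ l))%N; [rewrite dvdn_gcd dvdnn|rewrite h dvdn1].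
Qed.

Lemma minimal_exponent_div (M k : nat) : (k == 0)%N || ~~ (M %| 10 ^ k.-1)%N ->
  (k.-1 == 0)%N || ~~ (M %/ gcdn M 10 %| 10 ^ k.-1.-1)%N.
Proof.
case: k => [|[|k]] //= /negP nd; apply/negP => d; apply: nd.
rewrite -[M in (M %| _)%N](divnK (dvdn_gcdl M 10)) expnSr.
by apply: dvdn_mul => //; exact: dvdn_gcdr.
Qed.

(** For [M = 1] this is the sum of squares in Parseval's identity; larger [M] add the
    correlations with the shifts by the subgroup of order [M] of the circle. *)
Definition dcorr (l M : nat) x : R := \sum_(h < 10 ^ l) \sum_(j < M)
  dprod l (x + h%:R / 10 ^+ l) * dprod l (x + h%:R / 10 ^+ l + j%:R / M%:R).

(** Peeling off the first digit factor reduces the subgroup of order [M] of the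
    circle to its image under multiplication by 10, of order [M / gcd M 10], and
    every such step whose kernel is nontrivial gains the factor of [psi_gap]. *)
Lemma dprod_corr_step l M x : (M %| 10 ^ l.+1)%N ->
  dcorr l.+1 M x * (if (M == 1)%N then 1 else 57 / 50) <=
  (gcdn M 10)%:R * dcorr l (M %/ gcdn M 10) (10 * x).
Proof.
move=> Ml; set g := gcdn M 10; have [g0 mg Mg co M1] := gcd10_cases Ml; rewrite -/g in g0 mg Mg co M1.
set m := (10 %/ g)%N in mg co; set M' := (M %/ g)%N in Mg co *.
have M0 : (0 < M)%N by rewrite (dvdn_gt0 _ Ml) // expn_gt0.
have M'0 : (0 < M')%N by case: (M') Mg M0 => // <-.
pose z (h : nat) := 10 * x + h%:R / 10 ^+ l.
have TT : (10 ^+ l : R) != 0 by rewrite expf_neq0.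
have nM : (M%:R : R) != 0 by rewrite pnatr_eq0 -lt0n.
have nM' : (M'%:R : R) != 0 by rewrite pnatr_eq0 -lt0n.
have ng : (g%:R : R) != 0 by rewrite pnatr_eq0 -lt0n.
have gE : (g%:R : R) = M%:R / M'%:R by rewrite -Mg natrM mulrAC divff ?mul1r.
have mE : (m%:R : R) = 10 * M'%:R / M%:R.
  by apply: (mulIf ng); rewrite -[LHS]natrM mg gE; field; rewrite nM nM'.
have E : dcorr l.+1 M x = \sum_(h < 10 ^ l) \sum_(j < M')
    dprod l (z h) * dprod l (z h + (m * j)%:R / M'%:R) *
    \sum_(b < 10) \sum_(i < g) psi10 (x + h%:R / 10 ^+ l.+1 - alpha) b *
       psi10 (x + h%:R / 10 ^+ l.+1 - alpha + j%:R / M%:R) (b + m * i).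
  have sumM (F : nat -> R) : \sum_(j < M) F j = \sum_(j < M') \sum_(i < g) F (j + M' * i)%N.
    by rewrite -(sum_radix M' g F) Mg.
  pose G (h j : nat) := dprod l.+1 (x + h%:R / 10 ^+ l.+1) *
    dprod l.+1 (x + h%:R / 10 ^+ l.+1 + j%:R / M%:R).
  rewrite /dcorr expnSr (sum_radix _ _ (fun h => \sum_(j < M) G h j)).
  apply: eq_bigr => h _.
  transitivity (\sum_(b < 10) \sum_(j < M') \sum_(i < g) G (h + 10 ^ l * b)%N (j + M' * i)%N).
    by apply: eq_bigr => b _; exact: sumM.
  rewrite /G {G}.
  rewrite exchange_big /=; apply: eq_bigr => j _.
  rewrite mulr_sumr; apply: eq_bigr => b _; rewrite mulr_sumr; apply: eq_bigr => i _.
  rewrite !dprodS.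
  have -> : 10 * (x + (h + 10 ^ l * b)%:R / 10 ^+ l.+1) = z h + b%:R.
    by rewrite /z natrD natrM natrX exprS; field.
  have -> : 10 * (x + (h + 10 ^ l * b)%:R / 10 ^+ l.+1 + (j + M' * i)%:R / M%:R) =
      z h + (m * j)%:R / M'%:R + (b + m * i)%:R.
    by rewrite /z !natrD !natrM natrX exprS mE; field; rewrite nM nM'.
  rewrite !dprodDnat.
  have -> : psi (x + (h + 10 ^ l * b)%:R / 10 ^+ l.+1 - alpha) =
      psi10 (x + h%:R / 10 ^+ l.+1 - alpha) b.
    by congr psi; rewrite natrD natrM natrX exprS; field.
  have -> : psi (x + (h + 10 ^ l * b)%:R / 10 ^+ l.+1 + (j + M' * i)%:R / M%:R - alpha) =
      psi10 (x + h%:R / 10 ^+ l.+1 - alpha + j%:R / M%:R) (b + m * i).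
    by congr psi; rewrite !natrD !natrM natrX exprS mE; field; rewrite nM TT.
  by rewrite mulrACA [RHS]mulrC.
have -> : dcorr l M' (10 * x) = \sum_(h < 10 ^ l) \sum_(j < M')
    dprod l (z h) * dprod l (z h + (m * j)%:R / M'%:R).
  apply: eq_bigr => h _; rewrite -!mulr_sumr; congr (_ * _).
  rewrite -[LHS](@sum_coprime _ M' m (fun j => dprod l (z h + j%:R / M'%:R))) //.
  by move=> j; rewrite natrD mulrDl divff // addrA (dprodDnat _ _ 1).
rewrite E mulr_suml mulr_sumr; apply: ler_sum => h _.
rewrite mulr_suml mulr_sumr; apply: ler_sum => j _.
rewrite -mulrA [leRHS]mulrC ler_wpM2l ?mulr_ge0 ?dprod_ge0 //.
case: ifP => [|/negbT]; rewrite M1 => g1; last first.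
  by rewrite mulrC; apply: psi_gap mg _; rewrite -[(1 < g)%N]negbK.
have g1' : g = 1%N by lia.
rewrite mulr1 g1'; under eq_bigr do rewrite big_ord1 muln0 addn0.
exact: psi_corr_le1.
Qed.

(** Cauchy-Schwarz and Parseval alone give [M].  If [M] does not divide
    [10 ^ k.-1], then the subgroup of order [M] needs [k] multiplications by 10 to
    collapse, each of which gains the factor 57/50 in [dprod_corr_step]. *)
Lemma dprod_corr_le l M k x : (M %| 10 ^ l)%N -> (k == 0)%N || ~~ (M %| 10 ^ k.-1)%N ->
  (57 / 50) ^+ k * dcorr l M x <= M%:R.
Proof.
elim: l M k x => [|l ih] M k x Ml kM.
  have M1 : M = 1%N by apply/eqP; rewrite -dvdn1.
  have -> : k = 0%N by apply/eqP; move: kM; rewrite M1 dvd1n orbF.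
  by rewrite M1 /dcorr expn0 !big_ord1 /dprod !big_ord0 !mulr1.
have [g0 mg Mg co M1] := gcd10_cases Ml.
have Ml' : (M %/ gcdn M 10 %| 10 ^ l)%N.
  rewrite coprime_sym in co; rewrite -(Gauss_dvdr _ co).
  by rewrite -(dvdn_pmul2r g0) Mg mulnAC mg -expnS.
have := ih _ _ (10 * x) Ml' (minimal_exponent_div kM).
have := @dprod_corr_step l M x Ml.
set S := dcorr _ _ _; set S' := dcorr _ _ _ => A B; rewrite -[M in leRHS]Mg natrM.
have g1 : 0 <= (gcdn M 10)%:R :> R by [].
have S0 : 0 <= S.
  by apply: sumr_ge0 => h _; apply: sumr_ge0 => j _; rewrite mulr_ge0 ?dprod_ge0.
have w0 n : 0 <= (57 / 50 : R) ^+ n by rewrite exprn_ge0.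
suff C : (57 / 50) ^+ k * S <= (57 / 50) ^+ k.-1 * ((gcdn M 10)%:R * S').
  apply: (le_trans C); rewrite mulrCA [leRHS]mulrC; exact: ler_wpM2l.
apply: le_trans (ler_wpM2l (w0 _) A).
case: eqP A => [E1 _|_ _].
  have -> : k = 0%N by apply/eqP; move: kM; rewrite E1 dvd1n orbF.
  by rewrite mulr1.
case: k kM {B} => [|k] _ /=; last by rewrite exprSr le_eqVlt; apply/orP; left; apply/eqP; ring.
by rewrite !expr0 !mul1r; lra.
Qed.

End Correlation.

(** * A uniform bound for the digit products *)

Section SupBound.
Variables (R : realType) (alpha : R).
Implicit Types t x y : R.

Lemma nearest_int t : exists k : int, `|t - k%:~R| <= 1 / 2.
Proof.
exists (Num.floor (t + 1 / 2)).
by have /andP[a b] := floor_itv (t + 1 / 2); rewrite intrD in b; rewrite ler_norml; lra.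
Qed.

(** Since [10 (y - alpha) - (10 y - alpha) = - 9 alpha], the two consecutive arguments
    cannot both be close to integers. *)
Lemma psi_pair_le (th y : R) : 0 <= th <= 1 / 2 ->
  (forall k : int, th <= `|9 * alpha - k%:~R|) ->
  psi (y - alpha) * psi (10 * y - alpha) <= 1 - 4 / 5 * th ^+ 2.
Proof.
move=> th01 far; have [k1 h1] := nearest_int (y - alpha).
have [k2 h2] := nearest_int (10 * y - alpha).
have E (t : R) (k : int) : psi t = psi (t - k%:~R) by rewrite -mulrNz psiDint.
rewrite (E _ k1) (E (10 * y - alpha) k2).
have p1 := psi_le1 (y - alpha - k1%:~R); have p2 := psi_le1 (10 * y - alpha - k2%:~R).
have q1 := psi_ge0 (y - alpha - k1%:~R); have q2 := psi_ge0 (10 * y - alpha - k2%:~R).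
have [d1|d1] := leP (th / 11) `|y - alpha - k1%:~R|.
  apply: le_trans (psi_le_far th01 d1 h1); exact: ler_piMr.
have [d2|d2] := leP (th / 11) `|10 * y - alpha - k2%:~R|.
  apply: le_trans (psi_le_far th01 d2 h2); exact: ler_piMl.
have := far (k2 - 10 * k1); rewrite leNgt; case/negP.
rewrite intrB intrM (_ : 10%:~R = 10 :> R) // ltr_norml.
by move: d1 d2; rewrite !ltr_norml => /andP[a b] /andP[c d]; apply/andP; split; lra.
Qed.

Lemma dprod_le (th : R) l x : 0 <= th <= 1 / 2 ->
  (forall k : int, th <= `|9 * alpha - k%:~R|) ->
  dprod alpha l x <= (1 - 4 / 5 * th ^+ 2) ^+ l./2.
Proof.
move=> th01 far; elim/ltn_ind: l x => -[|[|l]] ih x.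
- by rewrite /dprod big_ord0.
- by rewrite /dprod big_ord1 psi_le1.
rewrite !dprodS mulrA -[l.+2./2]/(l./2).+1 [_ ^+ (l./2).+1]exprS; apply: ler_pM.
- by apply: mulr_ge0; exact: psi_ge0.
- exact: dprod_ge0.
- exact: psi_pair_le.
- exact: ih.
Qed.

End SupBound.

(** * Fourier expansion of the truncated digit sum *)

Section DigitFourier.
Variables (R : realType) (alpha : R).
Implicit Types x y : R.

Definition dsum (l u : nat) : nat := (\sum_(i < l) (u %/ 10 ^ i) %% 10)%N.

Lemma dsumS l u v : (v < 10)%N -> dsum l.+1 (v + 10 * u) = (v + dsum l u)%N.
Proof.
move=> v10; rewrite /dsum big_ord_recl expn0 divn1; congr (_ + _)%N.
  by rewrite addnC mulnC modnMDl modn_small.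
apply: eq_bigr => i _; congr (_ %% _)%N.
by rewrite /= /bump add1n expnS divnMA addnC mulnC divnMDl // (divn_small v10) addn0.
Qed.

Lemma dsum_periodic l : forall u, dsum l (u + 10 ^ l) = dsum l u.
Proof.
move=> u; apply: eq_bigr => i _.
have -> : (10 ^ l = 10 ^ (l - i.+1) * 10 * 10 ^ i)%N.
  by rewrite -mulnA -expnS -expnD subnK.
by rewrite addnC divnMDl ?expn_gt0 // modnMDl.
Qed.

Lemma digit_sumE l u : (u < 10 ^ l)%N -> digit_sum u = dsum l u.
Proof.
have h m : (u < 10 ^ m)%N -> forall d, dsum (m + d) u = dsum m u.
  move=> um d; rewrite /dsum big_split_ord /= [X in (_ + X)%N]big1 ?addn0 // => i _.
  by rewrite divn_small // (leq_trans um) // leq_exp2l // leq_addr.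
move=> ul; rewrite /digit_sum big_mkord -/(dsum u u).
rewrite -(h u (ltn_expl u (isT : 1 < 10)%N) l) addnC; exact: h.
Qed.

Lemma dsum_split l d u : dsum (l + d) u = (dsum l u + dsum d (u %/ 10 ^ l))%N.
Proof.
rewrite /dsum big_split_ord; congr (_ + _)%N; apply: eq_bigr => i _ /=.
by rewrite expnD divnMA.
Qed.

(** When adding [v] to [u] produces no carry out of the lowest [l] digits, the higher
    digits cancel in the difference of the digit sums. *)
Lemma digit_sum_diff l u v : (u %% 10 ^ l + v < 10 ^ l)%N ->
  (digit_sum (u + v))%:R - (digit_sum u)%:R = (dsum l (u + v))%:R - (dsum l u)%:R :> R.
Proof.
move=> uv; have [d d1] : exists d, (u + v < 10 ^ (l + d))%N.
  exists (u + v)%N; apply: (leq_trans (ltn_expl (u + v) (isT : 1 < 10)%N)).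
  by rewrite leq_exp2l // leq_addl.
have d2 : (u < 10 ^ (l + d))%N by apply: leq_ltn_trans d1; exact: leq_addr.
rewrite (digit_sumE d1) (digit_sumE d2) !dsum_split.
have -> : ((u + v) %/ 10 ^ l = u %/ 10 ^ l)%N.
  by rewrite {1}(divn_eq u (10 ^ l)) -addnA divnMDl ?expn_gt0 // (divn_small uv) addn0.
by rewrite !natrD; ring.
Qed.

Definition dhat (l : nat) x : R[i] :=
  ((10 ^- l)%:C)%C * \sum_(u < 10 ^ l) e (alpha * (dsum l u)%:R - u%:R * x).

(** Summing over the lowest digit first yields one factor and the coefficient at [10 x]. *)
Lemma cabs_dhat l x : cabs (dhat l x) = dprod alpha l x.
Proof.
elim: l x => [|l ih] x.
  rewrite /dhat big_ord1 /dsum big_ord0 mulr0 mul0r subrr e0 mulr1 cabs_real.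
  by rewrite /dprod big_ord0 expr0 invr1 normr1.
have -> : dhat l.+1 x = (10^-1%:C)%C * (\sum_(v < 10) e (v%:R * (alpha - x))) * dhat l (10 * x).
  rewrite /dhat expnS (sum_radix 10 _ (fun u => e (alpha * (dsum l.+1 u)%:R - u%:R * x))).
  rewrite mulrACA; congr (_ * _); first by rewrite -rmorphM /= -invfM -exprS.
  rewrite mulr_suml; apply: eq_bigr => v _; rewrite mulr_sumr; apply: eq_bigr => u _.
  by rewrite dsumS // -eD; congr e; rewrite [(v + 10 * u)%:R]natrD [(v + dsum l u)%:R]natrD natrM; ring.
rewrite cabsM ih dprodS; congr (_ * _).
rewrite cabsM cabs_real ger0_norm // -phiE mulrC -[LHS]/(psi (alpha - x)).
by rewrite -psiN opprB.
Qed.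

Lemma dhat_inversion l u : e (alpha * (dsum l u)%:R) =
  \sum_(h < 10 ^ l) dhat l (h%:R / 10 ^+ l) * e (u%:R * (h%:R / 10 ^+ l)) :> R[i].
Proof.
set Q := (10 ^ l)%N; have Q0 : (0 < Q)%N by rewrite expn_gt0.
have QE : (10 ^+ l : R) = Q%:R by rewrite natrX.
have nQ : (Q%:R : R) != 0 by rewrite pnatr_eq0 -lt0n.
wlog uQ : u / (u < Q)%N.
  move=> W; have := W (u %% Q)%N (ltn_pmod _ Q0).
  have pd : periodic_mod Q (fun j => (dsum l j)%:R : R) by move=> j; rewrite dsum_periodic.
  rewrite (periodic_modn u pd) => ->; apply: eq_bigr => h _; congr (_ * _).
  rewrite [in RHS](divn_eq u Q) natrD mulrDl eD natrM QE -mulrA [Q%:R * _]mulrC divfK //.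
  by rewrite -natrM e_nat mul1r.
rewrite /dhat.
transitivity (((10 ^- l)%:C)%C * \sum_(v < Q) \sum_(h < Q)
    e (alpha * (dsum l v)%:R) * e (h%:R * ((u%:R - v%:R) / Q%:R)) : R[i]).
  pose o := Ordinal uQ; rewrite (bigD1 o) //= [X in _ + X]big1 => [|v vu].
    rewrite -mulr_sumr orthogonality // eqxx addr0 mulrCA QE -(rmorph_nat (real_complex R)).
    by rewrite -rmorphM mulVf // rmorph1 mulr1.
  rewrite -mulr_sumr orthogonality // eq_sym.
  by rewrite -[nat_of_ord v == u]/(v == o) (negPf vu) mulr0.
rewrite exchange_big mulr_sumr; apply: eq_bigr => h _; rewrite -mulrA; congr (_ * _).
rewrite mulr_suml; apply: eq_bigr => v _; rewrite -!eD QE; congr e.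
by field.
Qed.

Definition kernel (J : seq nat) x : R := cabs (\sum_(m <- J) e (m%:R * x) : R[i]).

Lemma kernel_ge0 J x : 0 <= kernel J x. Proof. exact: cabs_ge0. Qed.

Lemma kernelDnat J x (n : nat) : kernel J (x + n%:R) = kernel J x.
Proof.
by congr cabs; apply: eq_bigr => m _; rewrite mulrDr -natrM eDnat.
Qed.

Lemma kernelDint J x (k : int) : kernel J (x + k%:~R) = kernel J x.
Proof.
case: k => k; first exact: kernelDnat.
by rewrite NegzE mulrNz -[in RHS](subrK k.+1%:R x) kernelDnat.
Qed.

(** Both phases are expanded by [dhat_inversion].  The sum is then organised by the
    difference [j] of the two frequencies, since the argument of the kernel depends on
    [n] only through [j (n + r)]. *)
Lemma truncated_corr_le J l n r :
  cabs (\sum_(m <- J) e (alpha * (dsum l (m * (n + r)))%:R - alpha * (dsum l (m * n))%:R) : R[i]) <=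
  \sum_(k < 10 ^ l) \sum_(j < 10 ^ l)
     dprod alpha l (k%:R / 10 ^+ l) * dprod alpha l (k%:R / 10 ^+ l + j%:R / 10 ^+ l) *
     kernel J ((j * (n + r) + k * r)%:R / 10 ^+ l).
Proof.
set Q := (10 ^ l)%N; have Q0 : (0 < Q)%N by rewrite expn_gt0.
have QE : (10 ^+ l : R) = Q%:R by rewrite natrX.
have nQ : (Q%:R : R) != 0 by rewrite pnatr_eq0 -lt0n.
pose D h := dhat l (h%:R / 10 ^+ l).
have -> : \sum_(m <- J) e (alpha * (dsum l (m * (n + r)))%:R - alpha * (dsum l (m * n))%:R) =
    \sum_(k < Q) \sum_(h < Q) conjc (D k) * D h *
       \sum_(m <- J) e (m%:R * (((n + r)%:R * h%:R - n%:R * k%:R) / 10 ^+ l)) :> R[i].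
  transitivity (\sum_(m <- J) \sum_(k < Q) \sum_(h < Q) conjc (D k) * D h *
     e (m%:R * (((n + r)%:R * h%:R - n%:R * k%:R) / 10 ^+ l))).
    apply: eq_bigr => m _; rewrite eD eN !dhat_inversion conjc_sum mulrC mulr_suml.
    apply: eq_bigr => k _; rewrite mulr_sumr; apply: eq_bigr => h _.
    rewrite rmorphM /= -eN mulrACA -eD; congr (_ * e _).
    by rewrite !natrM; ring.
  rewrite exchange_big; apply: eq_bigr => k _; rewrite exchange_big; apply: eq_bigr => h _.
  by rewrite -mulr_sumr.
apply: le_trans (cabs_sum _ _ _) _; apply: ler_sum => k _.
apply: le_trans (cabs_sum _ _ _) _.
pose f (h : nat) := dprod alpha l (k%:R / 10 ^+ l) * dprod alpha l (h%:R / 10 ^+ l) *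
  kernel J (((n + r)%:R * h%:R - n%:R * k%:R) / 10 ^+ l).
have pf : periodic_mod Q f.
  move=> h; rewrite /f natrD mulrDl QE divff // (dprodDnat _ _ _ 1); congr (_ * _).
  rewrite mulrDr addrAC mulrDl mulfK //; exact: kernelDnat.
rewrite (_ : \sum_(i < Q) _ = \sum_(i < Q) f i); last first.
  apply: eq_bigr => h _; rewrite /f cabsM; congr (_ * _).
  by rewrite cabsM cabsJ !cabs_dhat.
rewrite -(sum_shift k Q0 pf); apply: ler_sum => j _.
rewrite /f natrD mulrDl le_eqVlt; apply/orP; left; apply/eqP; congr (_ * kernel _ (_ / _)).
by rewrite !natrD !natrM natrD; ring.
Qed.

End DigitFourier.

(** * Sums over equidistant points *)

Section HarmonicSums.
Variable R : realType.
Implicit Types x y : R.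

Lemma harmonic_le l : \sum_(j < 10 ^ l) (j.+1%:R : R)^-1 <= (9 * l + 1)%:R.
Proof.
elim: l => [|l ih]; first by rewrite expn0 big_ord1 invr1 muln0.
have Q0 : (0 < 10 ^ l)%N by rewrite expn_gt0.
have nQ : (10 ^ l)%:R != 0 :> R by rewrite pnatr_eq0 -lt0n.
rewrite -(big_mkord xpredT (fun j => (j.+1%:R : R)^-1)) (big_cat_nat (n := 10 ^ l)) //=; last first.
  by rewrite leq_exp2l.
rewrite big_mkord mulnS -addnA addnC natrD lerD //.
apply: le_trans (_ : \sum_(10 ^ l <= j < 10 ^ l.+1) ((10 ^ l)%:R : R)^-1 <= _).
  rewrite big_nat_cond [leRHS]big_nat_cond; apply: ler_sum => j /andP[/andP[h _] _].
  by rewrite lef_pV2 ?posrE ?ltr0n // ler_nat ltnW.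
have E : (10 ^ l.+1 - 10 ^ l = 10 ^ l * 9)%N by rewrite expnSr; lia.
by rewrite sumr_const_nat E -[_ *+ (10 ^ l * 9)]mulr_natr natrM mulrA mulVf // mul1r.
Qed.

Lemma mod_shift (n0 : int) (M : nat) : (0 < M)%N ->
  exists2 c : nat, (c < M)%N & exists k : int, n0 = k * M%:Z + c%:Z.
Proof.
move=> M0; exists `|(n0 %% M%:Z)%Z|%N.
  by rewrite -ltz_nat gez0_abs ?modz_ge0 ?ltz_pmod //; lia.
by exists (n0 %/ M%:Z)%Z; rewrite gez0_abs ?modz_ge0 -?divz_eq //; lia.
Qed.

(** Among the [M] equidistant points [b + j / M] of the circle two can be close to the
    integers; the distances of the others grow linearly. *)
Lemma equidistant_sum_le (f : R -> R) (b U : R) (M l : nat) : (0 < M <= 10 ^ l)%N ->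
  (forall x (k : int), f (x + k%:~R) = f x) ->
  (forall x, 0 < x < 1 -> f x <= (2 * x)^-1 + (2 * (1 - x))^-1) ->
  0 <= U -> (forall j : nat, f (b + j%:R / M%:R) <= U) ->
  \sum_(j < M) f (b + j%:R / M%:R) <= 2 * U + M%:R * (9 * l + 1)%:R.
Proof.
move=> /andP[M0 Ml] pf fx U0 fU; have nM : (M%:R : R) != 0 by rewrite pnatr_eq0 -lt0n.
have Mp : (0 : R) < M%:R by rewrite ltr0n.
(* After a shift of the index, [b] is replaced by its residue [b0] modulo [1 / M]. *)
have [c cM [k Ek]] := mod_shift (Num.floor (b * M%:R)) M0.
have /andP[b1 b2] := floor_itv (b * M%:R).
pose b0 := b - (Num.floor (b * M%:R))%:~R / M%:R.
have b00 : 0 <= b0 by rewrite /b0 subr_ge0 ler_pdivrMr.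
have b01 : b0 < M%:R^-1.
  by rewrite -(ltr_pM2r Mp) mulVf // /b0 mulrBl divfK // ltrBlDl -(intrD _ _ 1).
have bE : b = b0 + k%:~R + c%:R / M%:R.
  rewrite /b0 Ek intrD intrM -[M%:Z%:~R]/(M%:R) -[c%:Z%:~R]/(c%:R) mulrDl mulfK //; ring.
clearbody b0; pose g j := f (b0 + j%:R / M%:R).
have gE j : f (b + j%:R / M%:R) = g (c + j)%N.
  rewrite /g -[RHS](pf _ k); congr f; rewrite bE natrD.
  by rewrite mulrDl; move: (_ / _) (_ / _) => p q; ring.
have gp : periodic_mod M g.
  by move=> j; rewrite /g natrD mulrDl divff // addrA (pf _ 1).
have gU j : g j <= U.
  have -> : g j = g (c + (j + (M - c)))%N by rewrite addnCA subnKC 1?ltnW // gp.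
  by rewrite -gE fU.
rewrite (eq_bigr (fun j : 'I_M => g (c + j)%N)) => [|j _]; last exact: gE.
rewrite (sum_shift c M0 gp).
have h0 n : 0 <= \sum_(j < n) (j.+1%:R : R)^-1.
  by apply: sumr_ge0 => j _; rewrite invr_ge0.
have hM n : (n <= M)%N -> \sum_(j < n) (j.+1%:R : R)^-1 <= (9 * l + 1)%:R.
  move=> nM'; apply: le_trans (harmonic_le l).
  rewrite -!(big_mkord xpredT (fun j => (j.+1%:R : R)^-1)).
  rewrite [leRHS](big_cat_nat (n := n)) ?(leq_trans nM') //= lerDl.
  by apply: sumr_ge0 => j _; rewrite invr_ge0.
have hg j : (j.+2 < M)%N ->
    g j.+1 <= M%:R / 2 * ((j.+1%:R)^-1 + ((M - j.+2)%:R)^-1).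
  move=> jM; have j1 : (0 : R) < j.+1%:R by rewrite ltr0n.
  have j2 : (0 : R) < (M - j.+2)%:R by rewrite ltr0n subn_gt0.
  have E2 : (M - j.+2)%:R = M%:R - j.+1%:R - 1 :> R.
    by rewrite natrB 1?ltnW // -[j.+2%:R]natr1 opprD addrA.
  have x1 : j.+1%:R / M%:R <= b0 + j.+1%:R / M%:R by rewrite lerDr.
  have x2 : (M - j.+2)%:R / M%:R <= 1 - (b0 + j.+1%:R / M%:R).
    rewrite E2 !mulrBl divff // mul1r; lra.
  have x1' : (0 : R) < j.+1%:R / M%:R by exact: divr_gt0.
  have x2' : (0 : R) < (M - j.+2)%:R / M%:R by exact: divr_gt0.
  apply: le_trans (fx _ _) _; first by apply/andP; split; lra.
  have inv (p q : R) : 0 < p -> p / M%:R <= q -> (2 * q)^-1 <= M%:R / 2 * p^-1.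
    move=> p0 pq; have p0' : 0 < p / M%:R by exact: divr_gt0.
    have -> : M%:R / 2 * p^-1 = (2 * (p / M%:R))^-1 by field; rewrite nM gt_eqF.
    by rewrite lef_pV2 ?posrE ?mulr_gt0 // ?ler_pM2l //; lra.
  by rewrite [leRHS]mulrDr; apply: lerD; apply: inv.
clearbody g; case: M M0 Ml nM Mp cM Ek b01 {bE gE b1 b2} gp hM hg fU => // -[|M] _ Ml nM Mp _ _ _ _ hM hg _.
  rewrite big_ord1; have := gU 0%N; have : (0 : R) <= 1%:R * (9 * l + 1)%:R by rewrite mulr_ge0.
  by lra.
rewrite big_ord_recl big_ord_recr /=.
have S : \sum_(i < M) g (bump 0 i) <= M.+2%:R * (9 * l + 1)%:R.
  apply: le_trans (_ : \sum_(i < M) (M.+2%:R / 2 * ((i.+1%:R)^-1 + ((M - i)%:R)^-1)) <= _).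
    by apply: ler_sum => i _; rewrite /bump add1n hg // !ltnS.
  rewrite -mulr_sumr big_split /= -mulrA ler_wpM2l //.
  have -> : \sum_(i < M) ((M - i)%:R : R)^-1 = \sum_(i < M) (i.+1%:R)^-1.
    rewrite [RHS](reindex_inj rev_ord_inj); apply: eq_bigr => i _ /=.
    by rewrite subnSK.
  by have := hM M ltac:(lia); lra.
have := gU 0%N; have := gU (bump 0 M); move: S; lra.
Qed.

End HarmonicSums.

(** * Counting residues in a window *)

Section Counting.

Lemma count_window_le (L n0 Y : nat) : (\sum_(n < L) (n0 <= n < n0 + Y) <= Y)%N.
Proof.
suff : (\sum_(n < L) (n0 <= n < n0 + Y) <= minn (L - n0) Y)%N.
  by move=> /leq_trans; apply; exact: geq_minr.
elim: L => [|L ih]; first by rewrite big_ord0.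
rewrite big_ord_recr /=; move: ih; move: (\sum_(n < L) _)%N => S.
by case: (boolP (n0 <= L < n0 + Y)%N); lia.
Qed.

Lemma count_interval_le (L c a X V : nat) : (0 < c)%N ->
  (\sum_(n < L) (a <= c * n + V < a + X) <= X %/ c + 1)%N.
Proof.
move=> c0; pose n0 := ((a - V + c.-1) %/ c)%N.
apply: leq_trans (count_window_le L n0 (X %/ c + 1)); apply: leq_sum => n _.
case: (boolP (a <= c * n + V < a + X)%N) => // /andP[h1 h2].
have -> // : (n0 <= n < n0 + (X %/ c + 1))%N.
have e1 := divn_eq (a - V + c.-1) c; have m1 := ltn_pmod (a - V + c.-1) c0.
have e2 := divn_eq X c; have m2 := ltn_pmod X c0.
rewrite -/n0 in e1; apply/andP; split.
  rewrite /n0 -ltnS ltn_divLR // mulSn mulnC; lia.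
rewrite -(ltn_pmul2l c0) !mulnDr muln1 [(c * n0)%N]mulnC [(c * (X %/ c))%N]mulnC; lia.
Qed.

(** Each quotient by [Q] confines [n] to a window of [X / c + 1] values. *)
Lemma count_mod_le (L c Q X V : nat) : (0 < c)%N -> (0 < Q)%N ->
  (\sum_(n < L) ((c * n + V) %% Q < X) <= ((c * L + V) %/ Q + 1) * (X %/ c + 1))%N.
Proof.
move=> c0 Q0; set q := ((c * L + V) %/ Q)%N.
apply: (@leq_trans (\sum_(n < L) \sum_(i < q.+1) (i * Q <= c * n + V < i * Q + X))%N).
  apply: leq_sum => n _; case: (boolP ((c * n + V) %% Q < X)%N) => // h.
  have iq : ((c * n + V) %/ Q < q.+1)%N.
    by rewrite ltnS leq_div2r // leq_add2r leq_pmul2l // ltnW.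
  rewrite (bigD1 (Ordinal iq)) //=; have e := divn_eq (c * n + V) Q.
  have -> : ((c * n + V) %/ Q * Q <= c * n + V < (c * n + V) %/ Q * Q + X)%N.
    by move: e h; move: (_ %/ _ * _)%N (_ %% _)%N => p w; lia.
  by rewrite leq_addr.
rewrite exchange_big /=.
apply: (@leq_trans (\sum_(i < q.+1) (X %/ c + 1))%N).
  by apply: leq_sum => i _; exact: count_interval_le.
by rewrite sum_nat_const card_ord [(q + 1)%N]addn1.
Qed.

End Counting.

(** * Bounds for the Dirichlet kernel *)

Section KernelBounds.
Variable R : realType.
Implicit Types x y : R.

Lemma kernel_le_size (J : seq nat) x : kernel J x <= (size J)%:R.
Proof.
rewrite (le_trans (cabs_sum _ _ _)) //; under eq_bigr do rewrite cabs_e.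
by rewrite big_const_seq count_predT iter_addr_0.
Qed.

Lemma kernel_sin_le a b x : kernel (index_iota a b) x * `|sin (pi * x)| <= 1.
Proof.
rewrite /kernel.
have [ba|ab] := leqP b a; first by rewrite big_geq // cabs0 mul0r.
rewrite -{1}[a]add0n big_addn big_mkord.
have -> : \sum_(i < b - a) e ((i + a)%:R * x) = e (a%:R * x) * \sum_(i < b - a) e (i%:R * x).
  by rewrite mulr_sumr; apply: eq_bigr => i _; rewrite -eD natrD mulrDl addrC.
by rewrite cabsM cabs_e mul1r cabs_geom sin_max.
Qed.

Lemma kernel_far a b x (d : R) : 0 < d -> (forall k : int, d <= `|x - k%:~R|) ->
  kernel (index_iota a b) x <= (2 * d)^-1.
Proof.
move=> d0 far; have [k hk] := nearest_int x.
have := kernel_sin_le a b (x - k%:~R); rewrite -mulrNz kernelDint mulrNz.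
have := jordan_norm hk; have := far k.
have := kernel_ge0 (index_iota a b) x; move: (kernel _ _) => K.
move: (`|x - _|) (`|sin _|) => p q K0 h1 h2 h3.
have d2 : 0 < 2 * d by lra.
by rewrite -[leRHS]mul1r ler_pdivlMr //; nra.
Qed.

Lemma kernel_near a b x : 0 < x < 1 ->
  kernel (index_iota a b) x <= (2 * x)^-1 + (2 * (1 - x))^-1.
Proof.
move=> /andP[x0 x1].
have i0 (y : R) : 0 < y -> 0 < (2 * y)^-1 by move=> y0; rewrite invr_gt0; lra.
have far (d : R) : 0 < d -> d <= x -> d <= 1 - x -> kernel (index_iota a b) x <= (2 * d)^-1.
  move=> d0 dx dx1; apply: kernel_far => // k.
  have [k0|k0] := leP k 0.
    have : (k%:~R : R) <= 0 by rewrite -[0]/(0%:~R) ler_int.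
    by move=> ?; rewrite ger0_norm; lra.
  have : (1 : R) <= k%:~R by rewrite -[1]/(1%:~R) ler_int; lia.
  by move=> ?; rewrite ler0_norm; lra.
have [h|h] := leP x (1 / 2).
  apply: (le_trans (far x _ _ _)); [lra|lra|lra|].
  by rewrite lerDl ltW // i0; lra.
apply: (le_trans (far (1 - x) _ _ _)); [lra|lra|lra|].
by rewrite lerDr ltW // i0; lra.
Qed.

End KernelBounds.

(** * Frequencies with a given denominator *)

Section TypeTwoKernelSum.
Variables (R : realType) (alpha : R).
Implicit Types x y : R.

Lemma dvdn_exp10P (M l : nat) : (M %| 10 ^ l)%N ->
  exists ab : 'I_l.+1 * 'I_l.+1, M = (2 ^ ab.1 * 5 ^ ab.2)%N.
Proof.
rewrite (_ : 10 = 2 * 5)%N // expnMn => Ml.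
have [a al Ea] : exists2 a, (a <= l)%N & gcdn M (2 ^ l) = (2 ^ a)%N.
  by apply/(dvdn_pfactor _ _ (isT : prime 2)); exact: dvdn_gcdr.
have [b bl Eb] : exists2 b, (b <= l)%N & gcdn M (5 ^ l) = (5 ^ b)%N.
  by apply/(dvdn_pfactor _ _ (isT : prime 5)); exact: dvdn_gcdr.
exists (Ordinal (al : (a < l.+1)%N), Ordinal (bl : (b < l.+1)%N)) => /=.
rewrite -Ea -Eb; apply/eqP; rewrite eqn_dvd; apply/andP; split.
  by rewrite muln_gcdl !muln_gcdr !dvdn_gcd Ml !(dvdn_mulr _ (dvdnn M)) (dvdn_mull _ (dvdnn M)).
rewrite Gauss_dvd ?dvdn_gcdl // Ea Eb; by rewrite coprimeXl // coprimeXr.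
Qed.

(** The frequencies [j / Q] whose reduced denominator is [M] lie in the subgroup of
    order [M]. *)
Lemma sum_denominator_le (Q M : nat) (f : R -> R) : (0 < Q)%N -> (M %| Q)%N ->
  (forall x, 0 <= f x) ->
  \sum_(j < Q | (Q %/ gcdn j Q)%N == M) f (j%:R / Q%:R) <= \sum_(j < M) f (j%:R / M%:R).
Proof.
move=> Q0 MQ f0; have M0 : (0 < M)%N by exact: dvdn_gt0 MQ.
have [[|d] QE] := dvdnP MQ; first by rewrite QE in Q0.
pose F (j : nat) : R := if (d.+1 %| j)%N then f (j%:R / Q%:R) else 0.
have F0 j : 0 <= F j by rewrite /F; case: ifP.
apply: (@le_trans _ _ (\sum_(j < Q) F j)).
  rewrite big_mkcond; apply: ler_sum => j _; case: eqP => [E|_]; last exact: F0.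
  rewrite /F; suff -> : (d.+1 %| j)%N by [].
  have -> : d.+1 = (Q %/ M)%N by rewrite QE mulnK.
  rewrite -E; set g := gcdn j Q.
  have gQ : (g %| Q)%N by exact: dvdn_gcdr.
  have -> : (Q %/ (Q %/ g) = g)%N.
    have g0 : (0 < g)%N by rewrite gcdn_gt0 Q0 orbT.
    by rewrite -{1}(divnK gQ) mulKn // divn_gt0 // dvdn_leq.
  exact: dvdn_gcdl.
have -> : \sum_(j < Q) F j = \sum_(c < d.+1) \sum_(i < M) F (c + d.+1 * i)%N.
  by rewrite -(sum_radix d.+1 M F) -QE.
rewrite big_ord_recl.
rewrite [X in _ + X]big1 => [|c _]; last first.
  rewrite big1 // => i _; rewrite /F ifF //; apply/negbTE.
  by rewrite dvdn_addl ?dvdn_mulr // gtnNdvd // /= /bump; have := ltn_ord c; lia.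
rewrite addr0; apply: ler_sum => j _; rewrite /F add0n dvdn_mulr // QE !natrM.
by rewrite -mulf_div divff ?mul1r // pnatr_eq0.
Qed.

(** Adding [V] turns the two-sided condition that [c k] is within [V] of a multiple of
    [Q] into a condition on one residue. *)
Definition near_period (Q V c k : nat) : bool := ((c * k + V) %% Q < 2 * V)%N.

Lemma near_periodP (Q V c k : nat) (t : int) : (0 < Q)%N ->
  `|(c * k)%:Z - t * Q%:Z| < V%:Z -> near_period Q V c k.
Proof.
move=> Q0; rewrite ltr_norml => /andP[a b]; rewrite /near_period.
pose x := (c * k)%:Z + V%:Z - t * Q%:Z.
have x0 : 0 < x by rewrite /x; lia.
have x1 : x < (2 * V)%:Z by rewrite /x; lia.
have E : ((c * k + V) %% Q)%N%:Z = (x %% Q%:Z)%Z.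
  by rewrite (_ : x = - t * Q%:Z + (c * k + V)%N%:Z) ?modzMDl ?modz_nat // /x; lia.
rewrite -ltz_nat E; apply: le_lt_trans x1; rewrite [leRHS](divz_eq x Q%:Z) lerDr mulr_ge0 //.
by rewrite divz_ge0 ?ltW // ltz_nat.
Qed.

Lemma count_near_period (Q V c : nat) : (0 < c)%N -> (0 < Q)%N ->
  (\sum_(k < Q) near_period Q V c k <= 6 * V + 3 * c)%N.
Proof.
move=> c0 Q0; have [VQ|QV] := leqP V Q; last first.
  apply: (@leq_trans (\sum_(k < Q) 1)%N).
    by apply: leq_sum => k _; case: near_period.
  by rewrite sum_nat_const card_ord muln1; lia.
apply: leq_trans (count_mod_le Q (2 * V) V c0 Q0) _.
rewrite divnMDl // -addnA.
have h : (V %/ Q <= 1)%N by rewrite -ltnS ltn_divLR // mul2n; lia.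
apply: (@leq_trans ((c + 2) * (2 * V %/ c + 1))%N).
  by rewrite leq_mul2r; apply/orP; right; lia.
have := leq_divM (2 * V) c; nia.
Qed.

End TypeTwoKernelSum.

(** * Averages of the Dirichlet kernel *)

Section CorrelationSums.
Variables (R : realType) (alpha : R).
Implicit Types x y : R.

(** While [n] runs over [M] consecutive integers, the arguments run over the [M]
    equidistant points [k r / Q + i / M]; the range of [n] is covered by [L / M + 1] such
    blocks. *)
Lemma sum_kernel_le (J1 J2 l L j k n0 r : nat) (U T : R) :
  let M := (10 ^ l %/ gcdn j (10 ^ l))%N in 0 <= U <= T ->
  (forall i : nat, kernel (index_iota J1 J2) ((k * r)%:R / 10 ^+ l + i%:R / M%:R) <= U) ->
  \sum_(n < L) kernel (index_iota J1 J2) ((j * (n0 + n + r) + k * r)%:R / 10 ^+ l) <=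
  2 * U * L%:R / M%:R + (2 * T + (9 * l + 1)%:R * (L%:R + 10 ^+ l)).
Proof.
move=> M /andP[U0 UT] KU; set K := kernel (index_iota J1 J2) in KU *.
set Q := (10 ^ l)%N in M KU *; have Q0 : (0 < Q)%N by rewrite expn_gt0.
have QE : (10 ^+ l : R) = Q%:R by rewrite natrX.
have nQ : (Q%:R : R) != 0 by rewrite pnatr_eq0 -lt0n.
have g0 : (0 < gcdn j Q)%N by rewrite gcdn_gt0 Q0 orbT.
pose j' := (j %/ gcdn j Q)%N.
have EQ : Q = (M * gcdn j Q)%N by rewrite divnK // dvdn_gcdr.
have Ej : j = (j' * gcdn j Q)%N by rewrite divnK // dvdn_gcdl.
have M0 : (0 < M)%N by case: (M) EQ Q0 => // ->.
have MQ : (M <= Q)%N by rewrite leq_div.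
have nM : (M%:R : R) != 0 by rewrite pnatr_eq0 -lt0n.
have co : coprime j' M by rewrite /coprime -(eqn_pmul2r g0) muln_gcdl -Ej -EQ mul1n.
pose g (i : nat) := K ((k * r)%:R / 10 ^+ l + i%:R / M%:R).
have pg : periodic_mod M g.
  by move=> i; rewrite /g /K natrD mulrDl divff // addrA (kernelDnat _ _ 1).
have pg' : periodic_mod M (fun i => g (j' * i)%N).
  move=> i /=; rewrite mulnDr; elim: (j') => [|c ih]; first by rewrite !mul0n.
  by rewrite -(periodic_modn _ pg) -[RHS](periodic_modn _ pg) addnC modnMDl.
rewrite (eq_bigr (fun n : 'I_L => g (j' * (n0 + r + n))%N)) => [|n _]; last first.
  rewrite /g; congr K; rewrite natrD mulrDl addrC; congr (_ + _).
  have EjR : j%:R = j'%:R * (gcdn j Q)%:R :> R by rewrite -natrM -Ej.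
  have EQR : Q%:R = M%:R * (gcdn j Q)%:R :> R by rewrite -natrM -EQ.
  rewrite [(n0 + n + r)%N]addnAC [(j * _)%:R]natrM [(j' * _)%:R]natrM EjR QE EQR; field.
  by rewrite nM pnatr_eq0 -lt0n.
apply: le_trans (sum_blocks_le L (n0 + r) M0 pg' (fun i => kernel_ge0 _ _)) _.
rewrite (sum_coprime M0 co pg).
have MQl : (0 < M <= 10 ^ l)%N by rewrite M0.
have := @equidistant_sum_le R K ((k * r)%:R / 10 ^+ l) U M l MQl
  (fun x i => kernelDint _ x i) (fun x => @kernel_near R J1 J2 x) U0 KU.
rewrite -/(\sum_(i < M) g i) => B.
have Lq : (L %/ M)%N%:R <= L%:R / M%:R :> R.
  by rewrite ler_pdivlMr ?ltr0n // -natrM ler_nat leq_divM.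
have H0 : (0 : R) <= (9 * l + 1)%:R by [].
have S0 : 0 <= \sum_(i < M) g i by apply: sumr_ge0 => i _; exact: kernel_ge0.
have Mp : (0 : R) < M%:R by rewrite ltr0n.
have MQr : M%:R <= Q%:R :> R by rewrite ler_nat.
rewrite QE -natr1; set H := (9 * l + 1)%:R in B H0 *.
apply: (@le_trans _ _ ((L%:R / M%:R + 1) * (2 * U + M%:R * H))).
  by apply: ler_pM => //; rewrite ?addr_ge0 // lerD2r.
have -> : (L%:R / M%:R + 1) * (2 * U + M%:R * H) =
    2 * U * L%:R / M%:R + (2 * U + H * (L%:R + M%:R)) by field.
rewrite lerD2l; apply: lerD; first by rewrite ler_pM2l.
by apply: ler_wpM2l => //; rewrite lerD2l.
Qed.

(** All the points [k r / Q + i / M] have the same multiple by [M], so they stay away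
    from the integers as soon as [M k r] stays away from the multiples of [Q]. *)
Lemma kernel_good_le (J1 J2 mu rho r M k i : nat) : (0 < M)%N -> (M %| 10 ^ (18 * rho))%N ->
  ~~ near_period (10 ^ (mu + 2 * rho)) (10 ^ (21 * rho)) (M * r) k ->
  kernel (index_iota J1 J2) ((k * r)%:R / 10 ^+ (mu + 2 * rho) + i%:R / M%:R) <=
  10 ^+ mu / 10 ^+ rho :> R.
Proof.
move=> M0 M18 far; set Q := (10 ^ (mu + 2 * rho))%N in far *.
set V := (10 ^ (21 * rho))%N in far *.
have Q0 : (0 < Q)%N by rewrite expn_gt0.
have V0 : (0 < V)%N by rewrite expn_gt0.
have QE : (10 ^+ (mu + 2 * rho) : R) = Q%:R by rewrite natrX.
have nQ : (Q%:R : R) != 0 by rewrite pnatr_eq0 -lt0n.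
have nM : (M%:R : R) != 0 by rewrite pnatr_eq0 -lt0n.
have Vp : (0 : R) < V%:R by rewrite ltr0n.
have Mp : (0 : R) < M%:R by rewrite ltr0n.
have Qp : (0 : R) < Q%:R by rewrite ltr0n.
apply: (@le_trans _ _ (2 * (V%:R / (Q%:R * M%:R)))^-1).
  apply: kernel_far; first by rewrite divr_gt0 // mulr_gt0.
  move=> t; rewrite QE leNgt; apply/negP => lt; case/negP: far.
  apply: (@near_periodP _ _ _ _ (t * M%:Z - i%:Z)) => //.
  rewrite -(ltr_int R) intr_norm intrB intrM intrB intrM.
  rewrite -[(M * r * k)%N%:Z%:~R]/((M * r * k)%N%:R) -[Q%:Z%:~R]/(Q%:R).
  rewrite -[M%:Z%:~R]/(M%:R) -[i%:Z%:~R]/(i%:R) -[V%:Z%:~R]/(V%:R).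
  move: lt; rewrite ltr_pdivlMr ?mulr_gt0 // -[Q%:R * M%:R as X in _ * X]gtr0_norm ?mulr_gt0 //.
  rewrite -normrM (_ : (_ - _) * _ = (M * r * k)%:R - (t%:~R * M%:R - i%:R) * Q%:R) //.
  by rewrite !natrM; field; rewrite nM nQ.
have M18' : M%:R <= (10 ^ (18 * rho))%:R :> R by rewrite ler_nat dvdn_leq // expn_gt0.
have -> : (2 * (V%:R / (Q%:R * M%:R)))^-1 = Q%:R * M%:R / (2 * V%:R) :> R.
  by field; rewrite nM nQ gt_eqF.
rewrite ler_pdivrMr ?mulr_gt0 // mulrAC ler_pdivlMr ?exprn_gt0 //.
have -> : (10 ^+ mu * (2 * V%:R) : R) = 2 * ((10 ^ (18 * rho))%:R * Q%:R * 10 ^+ rho).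
  by rewrite -QE /V !natrX mulrCA -!exprD; congr (_ * _ ^+ _); lia.
have p0 : (0 : R) < 10 ^+ rho by rewrite exprn_gt0.
have Qr : 0 <= Q%:R * 10 ^+ rho :> R by rewrite mulr_ge0 ?ltW.
have := ler_wpM2r Qr M18'.
have : 0 <= (10 ^ (18 * rho))%:R * (Q%:R * 10 ^+ rho) :> R by rewrite mulr_ge0.
lra.
Qed.

(** The bound for the kernel that [kernel_good_le] provides where it applies, the
    trivial one elsewhere. *)
Definition kernel_cap (mu rho r M k : nat) : R :=
  if (M %| 10 ^ (18 * rho))%N &&
     ~~ near_period (10 ^ (mu + 2 * rho)) (10 ^ (21 * rho)) (M * r) k
  then 10 ^+ mu / 10 ^+ rho else 10 ^+ mu.

Lemma pow10_le_gap (rho : nat) : 10 ^+ rho <= (57 / 50) ^+ (18 * rho) :> R.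
Proof.
rewrite exprM; apply: lerXn2r; rewrite ?nnegrE ?exprn_ge0 //.
by lra.
Qed.

(** If [M] does not divide [10 ^ (18 rho)], then [dprod_corr_le] gains
    [1.14 ^ (18 rho) >= 10 ^ rho].  Otherwise only the few [k] for which [M k r] is close
    to a multiple of [10 ^ l] escape the gain of [kernel_good_le], and for these the
    uniform bound [s] makes the products small. *)
Lemma sum_fixed_denominator_le (mu rho r M : nat) (s : R) :
  let l := (mu + 2 * rho)%N in (M %| 10 ^ l)%N -> (0 < r < 10 ^ rho)%N ->
  (forall x, dprod alpha l x <= s) ->
  \sum_(k < 10 ^ l) \sum_(j < M)
    dprod alpha l (k%:R / 10 ^+ l) * dprod alpha l (k%:R / 10 ^+ l + j%:R / M%:R) *
    (kernel_cap mu rho r M k / M%:R) <=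
  10 ^+ mu * (10 ^- rho + 9 * 10 ^+ (21 * rho) * s ^+ 2).
Proof.
move=> l Ml /andP[r0 r1] sup.
have M0 : (0 < M)%N by rewrite (dvdn_gt0 _ Ml) // expn_gt0.
have Mp : (0 : R) < M%:R by rewrite ltr0n.
have T0 : (0 : R) < 10 ^+ mu by rewrite exprn_gt0.
have p0 : (0 : R) < 10 ^+ rho by rewrite exprn_gt0.
have s20 : 0 <= 9 * 10 ^+ (21 * rho) * s ^+ 2 
  by apply: mulr_ge0; [apply: mulr_ge0; rewrite ?exprn_ge0|exact: sqr_ge0].
have corrE (c : R) : \sum_(k < 10 ^ l) \sum_(j < M)
    dprod alpha l (k%:R / 10 ^+ l) * dprod alpha l (k%:R / 10 ^+ l + j%:R / M%:R) *
    (c / M%:R) = c * (dcorr alpha l M 0 / M%:R).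
  rewrite /dcorr mulr_suml mulr_sumr; apply: eq_bigr => k _.
  rewrite mulr_suml mulr_sumr; apply: eq_bigr => j _; rewrite add0r; ring.
have [M18|M18] := boolP (M %| 10 ^ (18 * rho))%N; last first.
  rewrite (eq_bigr (fun k : 'I_(10 ^ l) => \sum_(j < M)
    dprod alpha l (k%:R / 10 ^+ l) * dprod alpha l (k%:R / 10 ^+ l + j%:R / M%:R) *
    (10 ^+ mu / M%:R))) => [|k _]; last by rewrite /kernel_cap (negPf M18).
  rewrite corrE ler_pM2l //.
  have := @dprod_corr_le R alpha l M (18 * rho).+1 0 Ml M18.
  set D := dcorr _ _ _ _ => C.
  have D0 : 0 <= D.
    by apply: sumr_ge0 => h _; apply: sumr_ge0 => j _; rewrite mulr_ge0 ?dprod_ge0.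
  apply: (@le_trans _ _ (10 ^- rho)); last by rewrite lerDl.
  rewrite ler_pdivrMr // mulrC ler_pdivlMr //; apply: le_trans C.
  rewrite mulrC; apply: ler_wpM2r => //; apply: le_trans (pow10_le_gap rho) _.
  by rewrite exprS ler_peMl ?exprn_ge0 //; lra.
set np := near_period (10 ^ l) (10 ^ (21 * rho)) (M * r).
apply: (@le_trans _ _ (\sum_(k < 10 ^ l) \sum_(j < M)
    (dprod alpha l (k%:R / 10 ^+ l) * dprod alpha l (k%:R / 10 ^+ l + j%:R / M%:R) *
     (10 ^+ mu / 10 ^+ rho / M%:R) + (np k)%:R * (10 ^+ mu * s ^+ 2 / M%:R)))).
  apply: ler_sum => k _; apply: ler_sum => j _.
  rewrite /kernel_cap M18 /= -/l -/np; case: (np k) => /=; last by rewrite mul0r addr0.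
  rewrite mul1r; apply: (@le_trans _ _ (10 ^+ mu * s ^+ 2 / M%:R)).
    have TM : 0 <= 10 ^+ mu / M%:R :> R by rewrite divr_ge0 ?ltW.
    have dd : dprod alpha l (k%:R / 10 ^+ l) * dprod alpha l (k%:R / 10 ^+ l + j%:R / M%:R)
        <= s ^+ 2 by rewrite expr2; apply: ler_pM => //; exact: dprod_ge0.
    by have := ler_wpM2r TM dd; rewrite [10 ^+ mu * s ^+ 2]mulrC -[s ^+ 2 * _ / _]mulrA.
  by rewrite lerDr !mulr_ge0 ?dprod_ge0 ?invr_ge0 // ltW.
rewrite (eq_bigr (fun k : 'I_(10 ^ l) => \sum_(j < M)
    dprod alpha l (k%:R / 10 ^+ l) * dprod alpha l (k%:R / 10 ^+ l + j%:R / M%:R) *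
    (10 ^+ mu / 10 ^+ rho / M%:R) + (np k)%:R * (10 ^+ mu * s ^+ 2))) => [|k _]; last first.
  rewrite big_split /= sumr_const card_ord; congr (_ + _).
  by rewrite -[LHS]mulr_natr -!mulrA mulVf ?mulr1 // gt_eqF.
rewrite big_split /= corrE mulrDr lerD //.
  rewrite -[leRHS]mulr1; apply: ler_wpM2l; first by rewrite divr_ge0 ?ltW.
  by rewrite ler_pdivrMr // mul1r; have := @dprod_corr_le R alpha l M 0 0 Ml isT; rewrite mul1r.
rewrite -mulr_suml -natr_sum [leLHS]mulrCA ler_pM2l //.
apply: ler_wpM2r; first exact: sqr_ge0.
rewrite -natrX -natrM ler_nat.
have Mr0 : (0 < M * r)%N by rewrite muln_gt0 M0.
have Ql0 : (0 < 10 ^ l)%N by rewrite expn_gt0.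
apply: leq_trans (count_near_period (10 ^ (21 * rho)) Mr0 Ql0) _.
have : (M * r <= 10 ^ (21 * rho))%N.
  apply: (@leq_trans (10 ^ (18 * rho) * 10 ^ rho)%N).
    by apply: leq_mul (ltnW r1); rewrite dvdn_leq // expn_gt0.
  by rewrite -expnD leq_exp2l //; lia.
by lia.
Qed.

End CorrelationSums.

(** * Correlations of the truncated digit sum *)

Section TruncatedCorrelation.
Variables (R : realType) (alpha : R).
Implicit Types x y : R.

(** There are at most [l.+1 ^ 2] denominators [2 ^ a * 5 ^ b]. *)
Lemma sum_all_denominators_le (mu rho r : nat) (s : R) :
  let l := (mu + 2 * rho)%N in (0 < r < 10 ^ rho)%N ->
  (forall x, dprod alpha l x <= s) ->
  \sum_(k < 10 ^ l) \sum_(j < 10 ^ l)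
    dprod alpha l (k%:R / 10 ^+ l) * dprod alpha l (k%:R / 10 ^+ l + j%:R / 10 ^+ l) *
    (let M := (10 ^ l %/ gcdn j (10 ^ l))%N in kernel_cap R mu rho r M k / M%:R) <=
  l.+1%:R ^+ 2 * (10 ^+ mu * (10 ^- rho + 9 * 10 ^+ (21 * rho) * s ^+ 2)).
Proof.
move=> l hr sup; set Q := (10 ^ l)%N.
have Q0 : (0 < Q)%N by rewrite expn_gt0.
have QE : (10 ^+ l : R) = Q%:R by rewrite natrX.
pose den (j : nat) := (Q %/ gcdn j Q)%N.
pose G M k (x : R) := dprod alpha l (k%:R / 10 ^+ l) * dprod alpha l (k%:R / 10 ^+ l + x) *
  (kernel_cap R mu rho r M k / M%:R).
have G0 M k x : 0 <= G M k x.
  rewrite /G !mulr_ge0 ?dprod_ge0 ?invr_ge0 //.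
  by rewrite /kernel_cap; case: ifP; rewrite ?divr_ge0 ?exprn_ge0.
rewrite exchange_big /=.
pose B := 10 ^+ mu * (10 ^- rho + 9 * 10 ^+ (21 * rho) * s ^+ 2).
pose W (j : nat) := \sum_(k < Q) G (den j) k (j%:R / 10 ^+ l).
rewrite -/B -[leLHS]/(\sum_(j < Q) W j).
apply: (@le_trans _ _ (\sum_(j < Q) \sum_(ab : 'I_l.+1 * 'I_l.+1)
    if (den j == 2 ^ ab.1 * 5 ^ ab.2)%N then W j else 0)).
  apply: ler_sum => j _.
  have denQ : (den j %| 10 ^ l)%N by rewrite -/Q -{2}(divnK (dvdn_gcdr j Q)) dvdn_mulr.
  have [ab Eab] := dvdn_exp10P denQ.
  rewrite (bigD1 ab) //= {1}Eab eqxx lerDl; apply: sumr_ge0 => i _.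
  by case: ifP => // _; apply: sumr_ge0 => k _; exact: G0.
rewrite exchange_big /=.
apply: (@le_trans _ _ (\sum_(ab : 'I_l.+1 * 'I_l.+1) B)); last first.
  by rewrite sumr_const card_prod !card_ord -[leLHS]mulr_natl natrM expr2.
apply: ler_sum => ab _; set M := (2 ^ ab.1 * 5 ^ ab.2)%N.
have MQ : (M %| 10 ^ l)%N.
  rewrite (_ : 10 = 2 * 5)%N // expnMn /M.
  by apply: dvdn_mul; rewrite dvdn_exp2l // -ltnS.
rewrite -big_mkcond /=.
rewrite (eq_bigr (fun j : 'I_Q => \sum_(k < Q) G M k (j%:R / 10 ^+ l))) => [|j /eqP Ej]; last first.
  by rewrite /W Ej.
have GM0 (x : R) : 0 <= \sum_(k < Q) G M k x by apply: sumr_ge0 => k _; exact: G0.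
have := sum_denominator_le Q0 MQ GM0.
rewrite -QE => /le_trans; apply; rewrite exchange_big.
exact: sum_fixed_denominator_le.
Qed.

(** The two terms of [sum_kernel_le] are summed separately: the error term against all
    pairs of frequencies, that is [dcorr] with [M = 10 ^ l], and the main term by
    denominators. *)
Lemma truncated_corr_sum_le (mu nu rho J1 J2 n0 L r : nat) (s : R) :
  let l := (mu + 2 * rho)%N in (0 < r < 10 ^ rho)%N ->
  (J2 - J1 <= 10 ^ mu)%N -> (L <= 10 ^ nu)%N ->
  (forall x, dprod alpha l x <= s) ->
  \sum_(n < L) cabs (\sum_(m <- index_iota J1 J2)
    e (alpha * (dsum l (m * (n0 + n + r)))%:R - alpha * (dsum l (m * (n0 + n)))%:R) : R[i]) <=
  (2 * 10 ^+ mu + (9 * l + 1)%:R * (10 ^+ nu + 10 ^+ l)) * (10 ^+ l / (57 / 50) ^+ l) +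
  2 * 10 ^+ nu * (l.+1%:R ^+ 2 * (10 ^+ mu * (10 ^- rho + 9 * 10 ^+ (21 * rho) * s ^+ 2))).
Proof.
move=> l hr hJ hL sup; set Q := (10 ^ l)%N.
have Q0 : (0 < Q)%N by rewrite expn_gt0.
have QE : (10 ^+ l : R) = Q%:R by rewrite natrX.
pose D (k j : nat) := dprod alpha l (k%:R / 10 ^+ l) *
  dprod alpha l (k%:R / 10 ^+ l + j%:R / 10 ^+ l).
have D0 k j : 0 <= D k j by rewrite mulr_ge0 ?dprod_ge0.
pose den (j : nat) := (Q %/ gcdn j Q)%N.
pose C k j := kernel_cap R mu rho r (den j) k / (den j)%:R.
pose E : R := 2 * 10 ^+ mu + (9 * l + 1)%:R * (10 ^+ nu + 10 ^+ l).
have L0 : (L%:R : R) <= 10 ^+ nu by rewrite -natrX ler_nat.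
have T0 : (0 : R) <= 10 ^+ mu by rewrite exprn_ge0.
have capT M k : 0 <= kernel_cap R mu rho r M k <= 10 ^+ mu.
  rewrite /kernel_cap; case: ifP => _; last by rewrite T0 lexx.
  rewrite divr_ge0 ?exprn_ge0 //= ler_pdivrMr ?exprn_gt0 // ler_peMr //.
  by rewrite exprn_ege1 //; lra.
have E0 : 0 <= E.
  by rewrite /E addr_ge0 ?mulr_ge0 ?addr_ge0 ?exprn_ge0.
apply: (@le_trans _ _ (\sum_(k < Q) \sum_(j < Q) (2 * L%:R * (D k j * C k j) + D k j * E))).
  apply: (@le_trans _ _ (\sum_(n < L) \sum_(k < Q) \sum_(j < Q) D k j *
      kernel (index_iota J1 J2) ((j * (n0 + n + r) + k * r)%:R / 10 ^+ l))).
    by apply: ler_sum => n _; exact: truncated_corr_le.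
  rewrite exchange_big; apply: ler_sum => k _; rewrite exchange_big; apply: ler_sum => j _.
  rewrite -mulr_sumr /=.
  have M0 : (0 < den j)%N by rewrite divn_gt0 ?gcdn_gt0 ?Q0 ?orbT // dvdn_leq // dvdn_gcdr.
  apply: (@le_trans _ _ (D k j *
    (2 * kernel_cap R mu rho r (den j) k * L%:R / (den j)%:R +
      (2 * 10 ^+ mu + (9 * l + 1)%:R * (L%:R + 10 ^+ l))))).
    apply: ler_wpM2l => //; apply: sum_kernel_le => // i.
    have [cnd|cnd] := boolP ((den j %| 10 ^ (18 * rho))%N &&
        ~~ near_period (10 ^ l) (10 ^ (21 * rho)) (den j * r) k).
      by rewrite /kernel_cap cnd; case/andP: cnd => c1 c2; exact: kernel_good_le.
    rewrite /kernel_cap (negPf cnd); apply: le_trans (kernel_le_size _ _) _.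
    by rewrite size_iota -natrX ler_nat.
  rewrite mulrDr; apply: lerD; first by rewrite /C le_eqVlt; apply/orP; left; apply/eqP; ring.
  apply: ler_wpM2l => //; rewrite /E lerD2l; apply: ler_wpM2l => //; exact: lerD.
have -> : \sum_(k < Q) \sum_(j < Q) (2 * L%:R * (D k j * C k j) + D k j * E) =
    2 * L%:R * (\sum_(k < Q) \sum_(j < Q) D k j * C k j) + (\sum_(k < Q) \sum_(j < Q) D k j) * E.
  rewrite mulr_sumr mulr_suml -big_split; apply: eq_bigr => k _ /=.
  by rewrite mulr_sumr mulr_suml -big_split.
have S1 := sum_all_denominators_le hr sup.
have S2 : \sum_(k < Q) \sum_(j < Q) D k j <= 10 ^+ l / (57 / 50) ^+ l.
  rewrite ler_pdivlMr ?exprn_gt0 // mulrC.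
  have kM : (l == 0)%N || ~~ (10 ^ l %| 10 ^ l.-1)%N.
    case: (l) => // l' /=; apply/negP => /dvdn_leq; rewrite expn_gt0 => /(_ isT).
    by rewrite leq_exp2l // ltnn.
  have := @dprod_corr_le R alpha l Q l 0 (dvdnn _) kM; rewrite -QE; apply: le_trans.
  apply: ler_wpM2l; first by rewrite exprn_ge0.
  by apply: ler_sum => k _; apply: ler_sum => j _; rewrite /D add0r QE.
rewrite addrC; apply: lerD; first by rewrite -/E mulrC; exact: ler_wpM2l.
apply: ler_pM => //.
- by apply: sumr_ge0 => k _; apply: sumr_ge0 => j _; rewrite mulr_ge0 ?D0 // divr_ge0 //; case/andP: (capT (den j) k).
- by rewrite ler_pM2l.
Qed.

End TruncatedCorrelation.

(** * Carries *)

Section Carry.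
Variables (R : realType) (alpha : R).

(** A carry beyond the digit of index [mu + 2 rho] forces the [rho] digits below it to
    be all 9, a rare event that is counted on the multiples of [m]. *)
Lemma carry_count (mu nu rho m : nat) : (0 < rho)%N -> (2 * rho <= nu)%N ->
  (10 ^ mu.-1 <= m <= 10 ^ mu)%N ->
  (\sum_(n < (10 ^ nu).+1)
     ((m * n + 10 ^ (mu + rho)) %% 10 ^ (mu + 2 * rho) < 10 ^ (mu + rho)) <=
   22 * 10 ^ (nu - rho))%N.
Proof.
move=> rho0 nu2 /andP[m1 m2].
have m0 : (0 < m)%N by apply: leq_trans m1; rewrite expn_gt0.
have Q0 : (0 < 10 ^ (mu + 2 * rho))%N by rewrite expn_gt0.
apply: leq_trans (count_mod_le _ _ _ m0 Q0) _.
have h1 : ((m * (10 ^ nu).+1 + 10 ^ (mu + rho)) %/ 10 ^ (mu + 2 * rho) <= 10 ^ (nu - 2 * rho))%N.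
  rewrite -ltnS ltn_divLR // mulSn -expnD.
  have -> : (nu - 2 * rho + (mu + 2 * rho) = mu + nu)%N by lia.
  have a : (m * (10 ^ nu).+1 <= 10 ^ mu + 10 ^ (mu + nu))%N.
    by rewrite mulnS expnD leq_add // leq_mul2r m2 orbT.
  have d : (10 ^ (mu + rho) * 10 <= 10 ^ (mu + 2 * rho))%N by rewrite -expnSr leq_exp2l //; lia.
  have f : (10 ^ mu <= 10 ^ (mu + rho))%N by rewrite leq_exp2l // leq_addr.
  have g : (0 < 10 ^ mu)%N by rewrite expn_gt0.
  rewrite -(leq_add2r (10 ^ (mu + rho))) in a; apply: leq_ltn_trans a _.
  move: (10 ^ (mu + rho))%N (10 ^ (mu + 2 * rho))%N (10 ^ mu)%N (10 ^ (mu + nu))%N d f g => W Q p N d f g.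
  by clear -d f g; lia.
have h2 : (10 ^ (mu + rho) %/ m <= 10 * 10 ^ rho)%N.
  apply: (@leq_trans (10 ^ (mu + rho) %/ 10 ^ mu.-1)).
    by apply: leq_div2l => //; rewrite expn_gt0.
  rewrite -expnS leq_divLR ?expn_gt0 // ?dvdn_exp2l //; last by lia.
  by rewrite -expnD leq_exp2l //; lia.
have e1 : (10 ^ (nu - rho) = 10 ^ (nu - 2 * rho) * 10 ^ rho)%N by rewrite -expnD; congr (_ ^ _)%N; lia.
have p1 : (0 < 10 ^ (nu - 2 * rho))%N by rewrite expn_gt0.
have p2 : (0 < 10 ^ rho)%N by rewrite expn_gt0.
rewrite e1; apply: (@leq_trans ((2 * 10 ^ (nu - 2 * rho)) * (11 * 10 ^ rho))%N).
  by apply: leq_mul; lia.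
by rewrite mulnACA.
Qed.

Lemma no_carry (mu rho m n r : nat) : (m <= 10 ^ mu)%N -> (r < 10 ^ rho)%N ->
  ~~ ((m * n + 10 ^ (mu + rho)) %% 10 ^ (mu + 2 * rho) < 10 ^ (mu + rho))%N ->
  ((m * n) %% 10 ^ (mu + 2 * rho) + m * r < 10 ^ (mu + 2 * rho))%N.
Proof.
move=> m2 r2; have mr : (m * r < 10 ^ (mu + rho))%N.
  have [->|m0] := posnP m; first by rewrite mul0n expn_gt0.
  rewrite expnD; apply: (@leq_trans (m * 10 ^ rho)%N); first by rewrite ltn_pmul2l.
  by rewrite leq_mul2r m2 orbT.
have WQ : (10 ^ (mu + rho) <= 10 ^ (mu + 2 * rho))%N by rewrite leq_exp2l //; lia.
set Q := (10 ^ (mu + 2 * rho))%N in WQ *; set W := (10 ^ (mu + rho))%N in mr WQ *.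
have Q0 : (0 < Q)%N by rewrite expn_gt0.
rewrite -modnDml -leqNgt; have := ltn_pmod (m * n) Q0; move: (_ %% Q)%N => u uQ.
have [|h] := leqP Q (u + m * r)%N => //.
move=> h; have E : ((u + W) %% Q = u + W - Q)%N.
  rewrite -[in LHS](subnK (_ : Q <= u + W)%N) ?modnDr; last by lia.
  by rewrite modn_small //; lia.
by rewrite E; lia.
Qed.

(** Replacing the digit sum by its truncation changes a term, by at most 2, only if a carry occurs. *)
Lemma full_corr_sum_le (mu nu rho J1 J2 n0 n1 r : nat) :
  (0 < rho)%N -> (2 * rho <= nu)%N -> (10 ^ mu.-1 <= J1)%N -> (J2 <= (10 ^ mu).+1)%N ->
  (n0 <= n1 <= (10 ^ nu).+1)%N -> (r < 10 ^ rho)%N ->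
  \sum_(n0 <= n < n1) cabs (\sum_(m <- index_iota J1 J2)
    e (alpha * (digit_sum (m * (n + r)))%:R - alpha * (digit_sum (m * n))%:R) : R[i]) <=
  \sum_(n0 <= n < n1) cabs (\sum_(m <- index_iota J1 J2)
    e (alpha * (dsum (mu + 2 * rho) (m * (n + r)))%:R -
       alpha * (dsum (mu + 2 * rho) (m * n))%:R) : R[i]) +
  44 * ((J2 - J1)%:R * 10 ^+ (nu - rho)).
Proof.
move=> rho0 nu2 hJ1 hJ2 /andP[n01 n1nu] hr; set l := (mu + 2 * rho)%N.
pose bad m n := ((m * n + 10 ^ (mu + rho)) %% 10 ^ l < 10 ^ (mu + rho))%N.
apply: (@le_trans _ _ (\sum_(n0 <= n < n1) (cabs (\sum_(m <- index_iota J1 J2)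
    e (alpha * (dsum l (m * (n + r)))%:R - alpha * (dsum l (m * n))%:R) : R[i]) +
    \sum_(m <- index_iota J1 J2) 2 * (bad m n)%:R))).
  apply: ler_sum => n _.
  rewrite -lerBlDl; apply: (@le_trans _ _ (cabs (\sum_(m <- index_iota J1 J2)
      (e (alpha * (digit_sum (m * (n + r)))%:R - alpha * (digit_sum (m * n))%:R) -
       e (alpha * (dsum l (m * (n + r)))%:R - alpha * (dsum l (m * n))%:R) : R[i])))).
    rewrite sumrB lerBlDr; apply: le_trans (cabsD _ _); by rewrite subrK.
  apply: le_trans (cabs_sum _ _ _) _.
  rewrite big_nat_cond [leRHS]big_nat_cond; apply: ler_sum => m /andP[/andP[m1 m2] _].
  have [b|nb] := boolP (bad m n).
    by rewrite mulr1 (le_trans (cabsD _ _)) // cabsN !cabs_e; lra.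
  have mmu : (m <= 10 ^ mu)%N by lia.
  have nc := no_carry mmu hr nb.
  by rewrite mulnDr -!mulrBr (digit_sum_diff R nc) subrr cabs0 mulr0.
rewrite big_split /= lerD2l exchange_big /=.
rewrite mulrCA mulr_natl -sumr_const_nat big_nat_cond [leRHS]big_nat_cond.
apply: ler_sum => m /andP[/andP[m1 m2] _].
have := @carry_count mu nu rho m rho0 nu2; rewrite (leq_trans hJ1 m1) => /(_ ltac:(lia)) h.
rewrite -mulr_sumr (_ : 44 = 2 * 22) -?mulrA ?ler_pM2l //; last by lra.
rewrite -natr_sum -natrX -natrM ler_nat; apply: leq_trans h.
rewrite -(big_mkord xpredT (fun n => bad m n : nat)).
rewrite [leqRHS](big_cat_nat (n := n1)) //=; apply: leq_trans (leq_addr _ _).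
by rewrite [leqRHS](big_cat_nat (n := n0)) //= leq_addl.
Qed.

End Carry.

(** * The inequality of van der Corput *)

Section VanDerCorput.
Variable R : realType.

Lemma sum_window (V : nmodType) (n0 n1 j : nat) (f : nat -> V) : (j <= n0 <= n1)%N ->
  \sum_(k < n1) (if (n0 <= k + j < n1)%N then f (k + j)%N else 0) = \sum_(n0 <= n < n1) f n.
Proof.
move=> /andP[jn0 n01]; pose g n := if (n0 <= n < n1)%N then f n else 0.
rewrite -(big_mkord xpredT (fun k => g (k + j)%N)).
have -> : \sum_(0 <= k < n1) g (k + j)%N = \sum_(j <= k < n1 + j) g k.
  by rewrite -{2}[j]add0n big_addn addnK.
rewrite (big_cat_nat (n := n0)) ?(leq_trans n01) ?leq_addr //=.
rewrite big_nat_cond big1 ?add0r => [|n /andP[/andP[_ h] _]]; last first.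
  by rewrite /g leqNgt h.
rewrite (big_cat_nat (n := n1)) ?leq_addr //= [X in _ + X]big_nat_cond [X in _ + X]big1 ?addr0.
  by rewrite big_nat_cond [RHS]big_nat_cond; apply: eq_bigr => n /andP[h _]; rewrite /g h.
by move=> n /andP[/andP[h _] _]; rewrite /g [(n < n1)%N]ltnNge h andbF.
Qed.

(** Every one of the [H] translates of the inner sum has the same value; averaging over
    them and applying Cauchy-Schwarz leaves the correlations between two translates.
    Extended by zero, the summands may be translated inside [0, n1) because [H <= n0]. *)
Lemma van_der_corput (J : seq nat) (n0 n1 H : nat) (b : nat -> R[i]) (c : nat -> nat -> R[i])
    (T : R) : (0 < H <= n0)%N -> (n0 <= n1)%N ->
  (forall n, (n0 <= n < n1)%N -> cabs (b n) <= 1) ->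
  (forall m n, cabs (c m n) = 1) -> 0 <= T ->
  (forall r, (0 < r < H)%N ->
     \sum_(n0 <= n < n1) cabs (\sum_(m <- J) c m (n + r)%N * conjc (c m n)) <= T) ->
  \sum_(m <- J) cabs (\sum_(n0 <= n < n1) b n * c m n) ^+ 2 <=
  n1%:R * ((size J)%:R * n1%:R / H%:R + T).
Proof.
move=> /andP[H0 Hn0] n01 b1 c1 T0 hT.
have Hp : (0 : R) < H%:R by rewrite ltr0n.
pose w n := (n0 <= n < n1)%N.
pose beta n : R[i] := if w n then b n else 0.
pose C n n' : R := cabs (\sum_(m <- J) c m n * conjc (c m n')).
have C0 n n' : 0 <= C n n' by exact: cabs_ge0.
have CC n n' : C n n' = C n' n.
  rewrite /C -cabsJ conjc_sum; congr cabs; apply: eq_bigr => m _.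
  by rewrite rmorphM /= conjcK mulrC.
have Cdiag n : C n n <= (size J)%:R.
  rewrite /C (le_trans (cabs_sum _ _ _)) //.
  under eq_bigr do rewrite cabsM cabsJ c1 mulr1.
  by rewrite big_const_seq count_predT iter_addr_0.
have beta_le n : cabs (beta n) <= (w n)%:R.
  by rewrite /beta; case: ifP => h; [rewrite b1 | rewrite cabs0].
have shift m j : (j < H)%N ->
    \sum_(n0 <= n < n1) b n * c m n = \sum_(k < n1) beta (k + j)%N * c m (k + j)%N.
  move=> jH; have jn : (j <= n0 <= n1)%N by rewrite n01 (leq_trans (ltnW jH)).
  rewrite -(sum_window (fun n => b n * c m n) jn); apply: eq_bigr => k _.
  by rewrite /beta /w; case: ifP; rewrite ?mul0r.
have avg m : H%:R ^+ 2 * cabs (\sum_(n0 <= n < n1) b n * c m n) ^+ 2 <=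
    n1%:R * \sum_(k < n1) cabs (\sum_(j < H) beta (k + j)%N * c m (k + j)%N) ^+ 2.
  rewrite -exprMn.
  have -> : H%:R * cabs (\sum_(n0 <= n < n1) b n * c m n) =
      cabs (\sum_(k < n1) \sum_(j < H) beta (k + j)%N * c m (k + j)%N).
    rewrite exchange_big /= (eq_bigr (fun _ : 'I_H => \sum_(n0 <= n < n1) b n * c m n)) => [|j _]; last first.
      by rewrite -shift.
    rewrite sumr_const card_ord -[X in _ = cabs X]mulr_natl cabsM -(rmorph_nat (real_complex R)) cabs_real.
    by rewrite ger0_norm.
  apply: le_trans (sqr_sum_le (fun k : 'I_n1 => cabs (\sum_(j < H) beta (k + j)%N * c m (k + j)%N))).
  apply: lerXn2r; rewrite ?nnegrE ?cabs_ge0 ?cabs_sum //.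
  by apply: sumr_ge0 => k _; exact: cabs_ge0.
have expand : \sum_(m <- J) \sum_(k < n1) cabs (\sum_(j < H) beta (k + j)%N * c m (k + j)%N) ^+ 2 <=
    \sum_(j < H) \sum_(i < H) \sum_(k < n1) (w (k + j)%N && w (k + i)%N)%:R * C (k + j)%N (k + i)%N.
  set X := \sum_(m <- J) _; have X0 : 0 <= X.
    by apply: sumr_ge0 => m _; apply: sumr_ge0 => k _; exact: sqr_ge0.
  have XE : (X%:C)%C = \sum_(j < H) \sum_(i < H) \sum_(k < n1)
      beta (k + j)%N * conjc (beta (k + i)%N) *
      \sum_(m <- J) c m (k + j)%N * conjc (c m (k + i)%N).
    rewrite /X rmorph_sum /=.
    transitivity (\sum_(m <- J) \sum_(k < n1) \sum_(j < H) \sum_(i < H)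
        beta (k + j)%N * conjc (beta (k + i)%N) * (c m (k + j)%N * conjc (c m (k + i)%N))).
      apply: eq_bigr => m _; rewrite rmorph_sum /=; apply: eq_bigr => k _.
      rewrite cabs_sqr conjc_sum mulr_suml; apply: eq_bigr => j _.
      rewrite mulr_sumr; apply: eq_bigr => i _.
      by rewrite (rmorphM (@conjc R)) /= mulrACA.
    rewrite exchange_big /=.
    transitivity (\sum_(k < n1) \sum_(j < H) \sum_(i < H)
        beta (k + j)%N * conjc (beta (k + i)%N) *
        \sum_(m <- J) c m (k + j)%N * conjc (c m (k + i)%N)).
      apply: eq_bigr => k _; rewrite exchange_big; apply: eq_bigr => j _.
      by rewrite exchange_big; apply: eq_bigr => i _; rewrite mulr_sumr.
    by rewrite exchange_big; apply: eq_bigr => j _; rewrite exchange_big.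
  rewrite -[X]ger0_norm // -cabs_real XE.
  apply: le_trans (cabs_sum _ _ _) _; apply: ler_sum => j _.
  apply: le_trans (cabs_sum _ _ _) _; apply: ler_sum => i _.
  apply: le_trans (cabs_sum _ _ _) _; apply: ler_sum => k _.
  rewrite !cabsM cabsJ -/(C _ _); apply: ler_wpM2r => //.
  by rewrite -mulnb natrM; apply: ler_pM; rewrite ?cabs_ge0 ?beta_le.
have offdiag j i : (i < j)%N -> (j < H)%N ->
    \sum_(k < n1) (w (k + j)%N && w (k + i)%N)%:R * C (k + j)%N (k + i)%N <= T.
  move=> ij jH; have rH : (0 < j - i < H)%N by lia.
  apply: le_trans (hT _ rH).
  have inn : (i <= n0 <= n1)%N by rewrite n01; lia.
  rewrite -(sum_window (fun n => cabs (\sum_(m <- J) c m (n + (j - i))%N * conjc (c m n))) inn).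
  apply: ler_sum => k _; rewrite -/(w (k + i)%N); case: (w (k + i)%N); last by rewrite andbF mul0r.
  have -> : (k + i + (j - i) = k + j)%N by lia.
  by rewrite andbT /C; case: (w _); rewrite ?mul1r ?mul0r ?cabs_ge0 ?lexx.
have diag j : \sum_(k < n1) (w (k + j)%N && w (k + j)%N)%:R * C (k + j)%N (k + j)%N <=
    (size J)%:R * n1%:R.
  rewrite mulr_natr -[n1 in _ *+ n1]card_ord -sumr_const; apply: ler_sum => k _.
  by case: (_ && _); rewrite ?mul0r ?mul1r ?Cdiag.
have total : \sum_(j < H) \sum_(i < H) \sum_(k < n1)
    (w (k + j)%N && w (k + i)%N)%:R * C (k + j)%N (k + i)%N <=
    H%:R * ((size J)%:R * n1%:R + H%:R * T).
  rewrite mulr_natl -[H in _ *+ H]card_ord -sumr_const; apply: ler_sum => j _.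
  rewrite (bigD1 j) //=; apply: lerD; first exact: diag.
  apply: (@le_trans _ _ (\sum_(i < H | i != j) T)).
    apply: ler_sum => i ij; have [ltij|] := ltnP i j; first exact: offdiag.
    rewrite leq_eqVlt => /orP[/eqP/val_inj E|ji]; first by rewrite E eqxx in ij.
    rewrite (eq_bigr (fun k : 'I_n1 => (w (k + i)%N && w (k + j)%N)%:R * C (k + i)%N (k + j)%N)) => [|k _].
      exact: offdiag.
    by rewrite andbC CC.
  rewrite mulr_natl -[H in _ *+ H]card_ord -[leRHS]sumr_const big_mkcond; apply: ler_sum => i _.
  by case: ifP.
rewrite -(ler_pM2l (_ : 0 < H%:R ^+ 2)) ?exprn_gt0 // mulr_sumr.
apply: (@le_trans _ _ (\sum_(m <- J) n1%:R *
    \sum_(k < n1) cabs (\sum_(j < H) beta (k + j)%N * c m (k + j)%N) ^+ 2)).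
  by apply: ler_sum => m _; exact: avg.
rewrite -mulr_sumr mulrCA; apply: ler_wpM2l => //.
apply: le_trans expand _; apply: (le_trans total).
rewrite le_eqVlt; apply/orP; left; apply/eqP; field; exact: lt0r_neq0.
Qed.

Lemma sqr_sum_seq_le (J : seq nat) (a : nat -> R) :
  (\sum_(m <- J) a m) ^+ 2 <= (size J)%:R * \sum_(m <- J) a m ^+ 2.
Proof.
rewrite (big_nth 0%N) [X in _ * X](big_nth 0%N) !big_mkord.
exact: (sqr_sum_le (fun i : 'I_(size J) => a (nth 0%N J i))).
Qed.

End VanDerCorput.

(** * The bilinear sum *)

Section TypeTwoBound.
Variables (R : realType) (alpha : R).

Lemma type_two_sqr_le (mu nu rho : nat) (b : nat -> R[i]) (s : R) :
  (0 < rho < nu)%N -> (2 * rho <= nu)%N ->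
  (forall n, (10 ^ nu.-1 < n <= 10 ^ nu)%N -> cabs (b n) <= 1) ->
  let l := (mu + 2 * rho)%N in
  (forall x, dprod alpha l x <= s) ->
  (\sum_((10 ^ mu.-1).+1 <= m < (10 ^ mu).+1)
     cabs (\sum_((10 ^ nu.-1).+1 <= n < (10 ^ nu).+1)
       b n * e (alpha * (digit_sum (m * n))%:R))) ^+ 2 <=
  10 ^+ mu * ((10 ^ nu).+1%:R * (10 ^+ mu * (10 ^ nu).+1%:R / 10 ^+ rho +
   ((2 * 10 ^+ mu + (9 * l + 1)%:R * (10 ^+ nu + 10 ^+ l)) * (10 ^+ l / (57 / 50) ^+ l) +
    2 * 10 ^+ nu * (l.+1%:R ^+ 2 * (10 ^+ mu * (10 ^- rho + 9 * 10 ^+ (21 * rho) * s ^+ 2))) +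
    44 * (10 ^+ mu * 10 ^+ (nu - rho))))).
Proof.
move=> /andP[rho0 rhonu] nu2 b1 l sup.
set J1 := (10 ^ mu.-1).+1; set J2 := (10 ^ mu).+1.
set n0 := (10 ^ nu.-1).+1; set n1 := (10 ^ nu).+1.
have n01 : (n0 <= n1)%N by rewrite ltnS leq_exp2l // leq_pred.
have hJ : (J2 - J1 <= 10 ^ mu)%N by rewrite subSS leq_subr.
have sJ : (size (index_iota J1 J2))%:R <= 10 ^+ mu :> R by rewrite size_iota -natrX ler_nat.
have H0 : (0 < 10 ^ rho <= n0)%N.
  apply/andP; split; first by rewrite expn_gt0.
  by apply: leqW; rewrite leq_exp2l //; lia.
apply: le_trans (sqr_sum_seq_le _ _) _.
set T := (2 * 10 ^+ mu + _) * _ + _ + _.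
have s20 : 0 <= 10 ^- rho + 9 * 10 ^+ (21 * rho) * s ^+ 2.
  apply: addr_ge0; first by rewrite invr_ge0 exprn_ge0.
  by apply: mulr_ge0; [apply: mulr_ge0; rewrite ?exprn_ge0|exact: sqr_ge0].
have T0 : 0 <= T.
  apply: addr_ge0; last by rewrite !mulr_ge0 ?exprn_ge0.
  apply: addr_ge0; last by rewrite !mulr_ge0 ?exprn_ge0.
  by rewrite mulr_ge0 ?divr_ge0 ?exprn_ge0 // addr_ge0 ?mulr_ge0 ?addr_ge0 ?exprn_ge0.
have hT r : (0 < r < 10 ^ rho)%N ->
    \sum_(n0 <= n < n1) cabs (\sum_(m <- index_iota J1 J2)
      e (alpha * (digit_sum (m * (n + r)))%:R) * conjc (e (alpha * (digit_sum (m * n))%:R))) <= T.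
  move=> hr; have [r0 r1] := andP hr.
  rewrite (eq_bigr (fun n => cabs (\sum_(m <- index_iota J1 J2)
     e (alpha * (digit_sum (m * (n + r)))%:R - alpha * (digit_sum (m * n))%:R) : R[i]))); last first.
    by move=> n _; congr cabs; apply: eq_bigr => m _; rewrite -eN -eD.
  apply: le_trans (full_corr_sum_le (mu := mu) (n0 := n0) (n1 := n1) (J1 := J1) (J2 := J2) alpha rho0 nu2 _ _ _ r1) _.
  - by [].
  - by [].
  - by rewrite n01 /=.
  apply: lerD; last first.
    apply: ler_wpM2l => //; apply: ler_wpM2r; first by rewrite exprn_ge0.
    by rewrite -natrX ler_nat.
  rewrite -{1}[n0]add0n big_addn big_mkord.
  have hL : (n1 - n0 <= 10 ^ nu)%N by rewrite subSS leq_subr.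
  under eq_bigr => n _ do rewrite [(n + n0)%N]addnC.
  exact: truncated_corr_sum_le.
have vdc := @van_der_corput R (index_iota J1 J2) n0 n1 (10 ^ rho) b
  (fun m n => e (alpha * (digit_sum (m * n))%:R)) T H0 n01 b1 (fun m n => cabs_e _) T0 hT.
apply: ler_pM => //; first by apply: sumr_ge0 => m _; exact: sqr_ge0.
apply: (le_trans vdc); apply: ler_wpM2l => //; rewrite lerD2r natrX.
apply: ler_wpM2r; first by rewrite invr_ge0 exprn_ge0.
exact: ler_wpM2r.
Qed.

(** The size conditions make the error terms of [type_two_sqr_le] smaller than the
    diagonal contribution [10 ^ (2 (mu + nu) - rho)], up to the factor [(mu + nu) ^ 2]. *)
Lemma type_two_le (mu nu rho : nat) (b : nat -> R[i]) (s : R) :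
  (0 < rho)%N -> (54 * rho <= mu)%N -> (17 * mu + 88 * rho <= 18 * nu)%N -> (2 * rho < nu)%N ->
  (forall n, (10 ^ nu.-1 < n <= 10 ^ nu)%N -> cabs (b n) <= 1) ->
  (forall x, dprod alpha (mu + 2 * rho) x <= s) -> 10 ^+ (22 * rho) * s ^+ 2 <= 1 ->
  (\sum_((10 ^ mu.-1).+1 <= m < (10 ^ mu).+1)
     cabs (\sum_((10 ^ nu.-1).+1 <= n < (10 ^ nu).+1)
       b n * e (alpha * (digit_sum (m * n))%:R))) ^+ 2 <=
  200 * (mu + nu)%:R ^+ 2 * (10 ^+ (mu + nu)) ^+ 2 / 10 ^+ rho.
Proof.
move=> rho0 c1 c2 c3 b1 sup small.
have rn : (0 < rho < nu)%N by lia.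
apply: le_trans (type_two_sqr_le rn ltac:(lia) b1 sup) _.
set l := (mu + 2 * rho)%N; set N := (mu + nu)%N.
pose p n : R := 10 ^+ n.
have p0 n : 0 < p n by rewrite exprn_gt0.
have pD m n : p (m + n)%N = p m * p n by rewrite /p exprD.
have p1 n : 1 <= p n by rewrite exprn_ege1 //; lra.
have ple m n : (m <= n)%N -> p m <= p n by move=> mn; rewrite ler_eXn2l //; lra.
rewrite -/(p mu) -/(p nu) -/(p rho) -/(p l) -/(p N) -/(p (21 * rho)%N) -/(p (nu - rho)%N).
set X := p N / p rho.
have X0 : 0 < X by rewrite divr_gt0.
have XE : X * p rho = p N by rewrite divfK // gt_eqF.
have N1 : 1 <= N%:R :> R by rewrite ler1n; lia.
have n1le : (10 ^ nu).+1%:R <= 2 * p nu.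
  by rewrite -natr1 natrX -/(p nu); have := p1 nu; lra.
have A1 : p mu * (10 ^ nu).+1%:R / p rho <= 2 * X.
  rewrite /X /N pD mulrA ler_pM2r ?invr_gt0 // mulrCA ler_pM2l //.
have A2 : 44 * (p mu * p (nu - rho)%N) <= 44 * X.
  rewrite ler_pM2l // /X ler_pdivlMr // -mulrA -pD /N [p (mu + nu)%N]pD ler_pM2l //; apply: ple; lia.
have A3 : 2 * p nu * (l.+1%:R ^+ 2 * (p mu * ((p rho)^-1 + 9 * p (21 * rho)%N * s ^+ 2))) <=
    20 * N%:R ^+ 2 * X.
  have t1 : 9 * p (21 * rho)%N * s ^+ 2 <= 9 * (p rho)^-1.
    rewrite -mulrA ler_pM2l // -[leRHS]mul1r ler_pdivlMr //.
    rewrite mulrAC -pD (_ : 21 * rho + rho = 22 * rho)%N //; lia.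
  have t2 : (l.+1%:R : R) ^+ 2 <= N%:R ^+ 2.
    by apply: lerXn2r; rewrite ?nnegrE // ler_nat /l /N; lia.
  have -> : 20 * N%:R ^+ 2 * X = 2 * p nu * (N%:R ^+ 2 * (p mu * (10 * (p rho)^-1))).
    by rewrite /X /N pD; field; rewrite gt_eqF.
  apply: ler_wpM2l; first by rewrite mulr_ge0 // ltW.
  have q0 : 0 <= (p rho)^-1 by rewrite invr_ge0 ltW.
  apply: ler_pM; [by rewrite exprn_ge0| |exact: t2|].
    apply: mulr_ge0; first exact: ltW.
    by apply: addr_ge0 => //; apply: mulr_ge0; [rewrite mulr_ge0 // ltW|exact: sqr_ge0].
  by rewrite ler_pM2l //; lra.
have A4 : (2 * p mu + (9 * l + 1)%:R * (p nu + p l)) * (p l / (57 / 50) ^+ l) <= 22 * N%:R * X.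
  (* The exponents 3 rho and mu + 5 rho - nu needed below are at most l / 18. *)
  have w1 k : (18 * k <= l)%N -> p k <= (57 / 50) ^+ l.
    move=> kl; apply: le_trans (pow10_le_gap R k) _; rewrite ler_weXn2l //; lra.
  have wl0 : (0 : R) < (57 / 50) ^+ l by rewrite exprn_gt0.
  rewrite mulrA ler_pdivrMr //.
  have h1 : 2 * p mu + (9 * l + 1)%:R * (p nu + p l) <= 11 * N%:R * (p nu + p l).
    have a : p mu <= p l by apply: ple; rewrite /l; lia.
    have c : (9 * l + 1)%:R <= 9 * N%:R :> R.
      by rewrite -[9 * N%:R]natrM ler_nat /l /N; lia.
    have Y0 : 0 <= p nu + p l by rewrite addr_ge0 ?ltW.
    have := ler_wpM2r Y0 c; have := ler_wpM2r Y0 N1; have := ltW (p0 nu).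
    by move: a; clear; move: (p mu) (p l) (p nu) (N%:R : R) ((9 * l + 1)%:R : R) => x y z n k; lra.
  apply: (@le_trans _ _ (11 * N%:R * (p nu + p l) * p l)).
    by apply: ler_wpM2r => //; exact: ltW.
  have h2 : p nu * p l <= X * (57 / 50) ^+ l.
    rewrite mulrAC ler_pdivlMr // -!pD.
    apply: (@le_trans _ _ (p N * p (3 * rho)%N)); first by rewrite -pD ple // /l /N; lia.
    by rewrite ler_pM2l // w1 // /l; lia.
  have h3 : p l * p l <= X * (57 / 50) ^+ l.
    rewrite mulrAC ler_pdivlMr // -!pD.
    apply: (@le_trans _ _ (p N * p (mu + 5 * rho - nu)%N)).
      by rewrite -pD ple // /l /N; lia.
    by rewrite ler_pM2l // w1 // /l; lia.
  have -> : 11 * N%:R * (p nu + p l) * p l = 11 * N%:R * (p nu * p l + p l * p l) by ring.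
  rewrite (_ : 22 * N%:R * X * _ = 11 * N%:R * (X * (57 / 50) ^+ l + X * (57 / 50) ^+ l)); last by ring.
  by apply: ler_wpM2l; [rewrite mulr_ge0|exact: lerD].
set T := _ + 44 * _.
have TX : p mu * (10 ^ nu).+1%:R / p rho + T <= 100 * N%:R ^+ 2 * X.
  have NN : N%:R <= N%:R ^+ 2 :> R by rewrite expr2 ler_peMl.
  have NX : N%:R * X <= N%:R ^+ 2 * X by rewrite ler_pM2r.
  have XX : X <= N%:R * X by rewrite ler_peMl // ltW.
  rewrite /T; lra.
rewrite mulrA; apply: (@le_trans _ _ (2 * p N * (100 * N%:R ^+ 2 * X))).
  have T0 : 0 <= T.
    rewrite /T; apply: addr_ge0; last by rewrite !mulr_ge0 // ltW.
    have w0 : 0 <= (57 / 50 : R) ^+ l by rewrite exprn_ge0.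
    have pl0 n : 0 <= p n by exact: ltW.
    apply: addr_ge0.
      by rewrite mulr_ge0 ?divr_ge0 // addr_ge0 ?mulr_ge0 // addr_ge0.
    rewrite !mulr_ge0 ?exprn_ge0 // addr_ge0 ?invr_ge0 //.
    by apply: mulr_ge0; [rewrite mulr_ge0|exact: sqr_ge0].
  apply: ler_pM; last exact: TX.
  - by rewrite mulr_ge0 // ltW.
  - by apply: addr_ge0 => //; rewrite !mulr_ge0 ?invr_ge0 // ltW.
  - by rewrite /N pD [leRHS]mulrCA ler_pM2l.
by rewrite le_eqVlt; apply/orP; left; apply/eqP; rewrite /X; ring.
Qed.

End TypeTwoBound.

(** * The constants *)

Section Constants.
Variable R : realType.

Lemma ln_pow_le (a b m n : nat) : (0 < a)%N -> (0 < b)%N -> (a%:R : R) ^+ m <= b%:R ^+ n ->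
  m%:R * ln (a%:R : R) <= n%:R * ln b%:R.
Proof.
move=> a0 b0 h; rewrite !mulr_natl -!lnXn ?ltr0n // ler_ln ?posrE ?exprn_gt0 ?ltr0n //.
Qed.

Lemma ln_nat_gt0 (a : nat) : (1 < a)%N -> 0 < ln (a%:R : R).
Proof. by move=> a1; rewrite ln_gt0 // ltr1n. Qed.

(** [3 ^ 41 <= 5 ^ 28] and [2 ^ 13 <= 10 ^ 4] bound the two factors by 1/28 and 4/13. *)
Lemma omega_bounds : 0 <= (omega : R) <= 1 / 91.
Proof.
rewrite /omega.
have l2 := @ln_nat_gt0 2 isT; have l3 := @ln_nat_gt0 3 isT; have l10 := @ln_nat_gt0 10 isT.
have l5 := @ln_nat_gt0 5 isT.
have a1 : (41 / 28 : R) <= ln 5 / ln 3.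
  rewrite ler_pdivlMr //; have := @ln_pow_le 3 5 41 28 isT isT ltac:(lra); lra.
have a2 : ln 5 / ln 3 <= (3 / 2 : R).
  rewrite ler_pdivrMr //; have := @ln_pow_le 5 3 2 3 isT isT ltac:(lra); lra.
have a3 : ln 2 / ln 10 <= (4 / 13 : R).
  rewrite ler_pdivrMr //; have := @ln_pow_le 2 10 13 4 isT isT ltac:(lra); lra.
have a4 : (0 : R) <= ln 2 / ln 10 by rewrite divr_ge0 ?ltW.
by apply/andP; split; nra.
Qed.

Lemma c1_le : (c1 : R) <= 1 / 637.
Proof.
have /andP[_ h] := omega_bounds; rewrite /c1.
have : Num.min (4 * omega) (pi ^+ 2 / 12 * (9 / (11 * ln 10))) <= 4 * omega :> R.
  by rewrite ge_min lexx.
lra.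
Qed.

(** [exp (5 / 2) >= (1 + 1 / 10) ^ 25 >= 10]. *)
Lemma ln10_le : ln (10 : R) <= 5 / 2.
Proof.
have h : (10 : R) <= expR (5 / 2).
  have : (11 / 10 : R) ^+ 25 <= expR (1 / 10) ^+ 25.
    apply: lerXn2r; rewrite ?nnegrE ?expR_ge0 //.
    by apply: le_trans (expR_ge1Dx _); lra.
  rewrite -expRM_natl (_ : 25%:R * (1 / 10) = 5 / 2 :> R); last by lra.
  by move=> h; apply: le_trans h; lra.
by rewrite -[leRHS]expRK ler_ln ?posrE ?expR_gt0 //.
Qed.

Lemma C_II_bounds : 60 * 10 ^+ 3 <= (C_II : R) < 64 * 10 ^+ 3.
Proof.
have l10 := ltW (@ln_nat_gt0 10 isT); have l10' := ln10_le.
have E : (C_II : R) ^+ 2 = 40 * (1 + 10 ^+ 3 * ln 10 + 10 ^+ 8).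
  by rewrite /C_II !exprMn !sqr_sqrtr //; lra.
have C0 : 0 <= (C_II : R) by rewrite /C_II !mulr_ge0 ?sqrtr_ge0.
apply/andP; split; first by rewrite -(@ler_pXn2r _ 2) ?nnegrE // E; lra.
by rewrite -(@ltr_pXn2r _ 2) ?nnegrE ?E //; lra.
Qed.

Lemma gamma_le1 (alpha : R) : gamma alpha <= 1.
Proof.
rewrite /gamma ler_pdivrMr ?mul1r; last exact: (@ln_nat_gt0 10).
set S := [set _ | _ in _]%classic.
have ub : ubound S 10.
  move=> _ [t _ <-]; rewrite -(ger0_norm (_ : 0 <= (10 : R))) // -sqrtr_sqr.
  rewrite ler_sqrt ?exprn_ge0 // expr2; apply: ler_pM; rewrite ?cabs_ge0 ?phi_le10 //.
have S10 : sup S <= 10.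
  by apply: ge_sup => //; exists (Num.sqrt (phi (alpha + 0) * phi (alpha + 10 * 0))); exists 0.
have [s0|s0] := ltP 0 (sup S); first by rewrite ler_ln ?posrE.
by rewrite ln0 // ltW //; exact: (@ln_nat_gt0 10).
Qed.

Lemma eps_bounds (alpha : R) : 0 <= eps alpha <= 1 / 91.
Proof.
have /andP[w0 w1] := omega_bounds; have g1 := gamma_le1 alpha.
have l10 := @ln_nat_gt0 10 isT.
have t0 : 0 <= tau alpha.
  rewrite /tau; case: eqP => [//|ph]; rewrite le_min w0 /=.
  rewrite divr_ge0 ?(ltW l10) //.
  have : ln (phi alpha / 10) <= 0.
    by rewrite -ln1 ler_ln ?posrE ?ltr01 ?divr_gt0 ?psi_le1 // lt_neqAle cabs_ge0 andbT eq_sym; apply/eqP.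
  by lra.
rewrite /eps !le_min w0 t0 subr_ge0 g1 /=.
by rewrite ge_min w1.
Qed.

Lemma dist_int_le (x : R) (k : int) : dist_int x <= `|x - k%:~R|.
Proof.
apply: ge_inf; last by exists k.
by exists 0 => _ [j _ <-].
Qed.

Lemma dist_int_bounds (x : R) : 0 <= dist_int x <= 1 / 2.
Proof.
apply/andP; split.
  by apply: lb_le_inf; [exists `|x - 0%:~R|; exists 0 | move=> _ [j _ <-]].
by have [k hk] := nearest_int x; apply: le_trans (dist_int_le x k) hk.
Qed.

End Constants.

(** * The saving *)

Section TypeTwoSavings.
Variables (R : realType) (alpha : R).

Lemma powR10_nat (n : nat) : (10 : R) `^ n%:R = 10 ^+ n.
Proof. by rewrite powR_mulrn. Qed.

(** With [sigma = th ^ 2 N / 637], the first factor is at most [exp (110 sigma + 55)],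
    because [ln 10 <= 5 / 2], and the second at most [exp (- 169 sigma)]. *)
Lemma uniform_bound_small (th : R) (N mu rho : nat) : 0 <= th <= 1 / 2 ->
  333 * N%:R <= 1000 * mu%:R :> R -> 1 <= th ^+ 2 * N%:R / 637 ->
  rho%:R <= 2 * (th ^+ 2 * N%:R / 637) + 1 -> (0 < rho)%N ->
  10 ^+ (22 * rho) * ((1 - 4 / 5 * th ^+ 2) ^+ (mu + 2 * rho)./2) ^+ 2 <= 1.
Proof.
move=> /andP[h0 h1] hmu s1 hrho rho0; set k := (mu + 2 * rho)./2.
have k2 : (mu <= k * 2)%N by rewrite /k; lia.
have e1 : ((1 - 4 / 5 * th ^+ 2) ^+ k) ^+ 2 <= expR (- (mu%:R * (4 / 5 * th ^+ 2))).
  have a0 : 0 <= 1 - 4 / 5 * th ^+ 2 by nra.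
  rewrite -exprM; apply: (@le_trans _ _ (expR (- (4 / 5 * th ^+ 2)) ^+ (k * 2))).
    apply: lerXn2r; rewrite ?nnegrE ?expR_ge0 //; exact: expR_ge1Dx.
  rewrite -expRM_natl ler_expR mulrN lerN2; apply: ler_wpM2r; last by rewrite ler_nat.
  by rewrite mulr_ge0 ?sqr_ge0.
have e2 : (10 : R) ^+ (22 * rho) <= expR (55 * rho%:R).
  have -> : (10 : R) = expR (ln 10) by rewrite lnK // posrE.
  rewrite -expRM_natl ler_expR natrM.
  have := ln10_le R; have : (0 : R) <= rho%:R by []; nra.
apply: (@le_trans _ _ (expR (55 * rho%:R) * expR (- (mu%:R * (4 / 5 * th ^+ 2))))).
  by apply: ler_pM; [rewrite exprn_ge0|exact: sqr_ge0| |].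
rewrite -expRD -[leRHS](expR0 R) ler_expR subr_le0.
have t0 : 0 <= th ^+ 2 by exact: sqr_ge0.
have := ler_wpM2r t0 hmu; move: hrho s1; clear.
move: (th ^+ 2) (rho%:R : R) (mu%:R : R) (N%:R : R) => t r m n; lra.
Qed.

Lemma type_two_trivial (mu nu : nat) (b : nat -> R[i]) :
  (forall n, (10 ^ nu.-1 < n <= 10 ^ nu)%N -> cabs (b n) <= 1) ->
  \sum_((10 ^ mu.-1).+1 <= m < (10 ^ mu).+1)
     cabs (\sum_((10 ^ nu.-1).+1 <= n < (10 ^ nu).+1)
       b n * e (alpha * (digit_sum (m * n))%:R)) <= 10 ^+ (mu + nu).
Proof.
move=> b1; have card n : (\sum_((10 ^ n.-1).+1 <= m < (10 ^ n).+1) (1 : R)) <= 10 ^+ n.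
  by rewrite sumr_const_nat -natrX ler_nat subSS leq_subr.
rewrite exprD; apply: (@le_trans _ _ (\sum_((10 ^ mu.-1).+1 <= m < (10 ^ mu).+1) (10 ^+ nu : R))).
  apply: ler_sum => m _; apply: le_trans (cabs_sum _ _ _) _; apply: le_trans (card nu).
  rewrite big_nat_cond [leRHS]big_nat_cond; apply: ler_sum => n /andP[/andP[n1 n2] _].
  by rewrite cabsM cabs_e mulr1; apply: b1; rewrite n1 -ltnS.
have -> : \sum_((10 ^ mu.-1).+1 <= m < (10 ^ mu).+1) (10 ^+ nu : R) =
    (\sum_((10 ^ mu.-1).+1 <= m < (10 ^ mu).+1) 1) * 10 ^+ nu.
  by rewrite mulr_suml; apply: eq_bigr => m _; rewrite mul1r.
by apply: ler_wpM2r; [rewrite exprn_ge0|exact: card].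
Qed.

(** With [sigma = th ^ 2 N / 637], the bound is trivial unless [10 ^ sigma] exceeds
    [60000 N].  In that case [sigma >= 4] and [N >= 2548 sigma], which leaves room for a
    [rho] just above [2 sigma] in [type_two_le]. *)
Lemma type_two_savings (th : R) (mu nu : nat) (b : nat -> R[i]) :
  0 <= th <= 1 / 2 -> (forall k : int, th <= `|9 * alpha - k%:~R|) ->
  (0 < mu + nu)%N -> (333 * (mu + nu) <= 1000 * mu)%N -> (90 * mu <= 91 * nu)%N ->
  (forall n, (10 ^ nu.-1 < n <= 10 ^ nu)%N -> cabs (b n) <= 1) ->
  \sum_((10 ^ mu.-1).+1 <= m < (10 ^ mu).+1)
     cabs (\sum_((10 ^ nu.-1).+1 <= n < (10 ^ nu).+1)
       b n * e (alpha * (digit_sum (m * n))%:R)) <=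
  60 * 10 ^+ 3 * (mu + nu)%:R *
    10 `^ ((mu + nu)%:R - th ^+ 2 * (mu + nu)%:R / 637).
Proof.
move=> th01 far N0 hmu hnu b1; have [h0 h1] := andP th01.
set N := (mu + nu)%N in N0 hmu *; set S := \sum_(_ <= m < _) _.
have S0 : 0 <= S by apply: sumr_ge0 => m _; exact: cabs_ge0.
set sg := th ^+ 2 * N%:R / 637.
have Np : (0 : R) < N%:R by rewrite ltr0n.
have N1 : (1 : R) <= N%:R by rewrite ler1n.
have sg0 : 0 <= sg.
  by apply: divr_ge0; [apply: mulr_ge0; [exact: sqr_ge0|exact: ler0n]|exact: ler0n].
have t4 : th ^+ 2 <= 1 / 4 by nra.
have sgN : 2548 * sg <= N%:R by rewrite /sg; nra.
set y := (10 : R) `^ sg.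
have y0 : 0 < y by rewrite powR_gt0.
have -> : (10 : R) `^ (N%:R - sg) = 10 ^+ N / y.
  by rewrite powRB ?powR10_nat // pnatr_eq0 implybT.
rewrite mulrA ler_pdivlMr //.
have [ysmall|ybig] := leP y (60 * 10 ^+ 3 * N%:R).
  rewrite mulrC; apply: ler_pM => //; first exact: ltW.
  exact: type_two_trivial.
have sg4 : 4 <= sg.
  rewrite leNgt; apply/negP => sg4.
  have y4 : y <= 10 ^+ 4.
    rewrite -(powR10_nat 4); apply: ler_powR; first by lra.
    exact: ltW.
  have : 60 * 10 ^+ 3 <= 60 * 10 ^+ 3 * N%:R :> R by rewrite ler_peMr //; lra.
  by lra.
have /andP[r1 r2] := @truncn_itv R (2 * sg) ltac:(lra).
set rho := (Num.truncn (2 * sg)).+1.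
have rhoE : rho%:R = (Num.truncn (2 * sg))%:R + 1 :> R by rewrite /rho -natr1.
have ry : y ^+ 2 <= 10 ^+ rho.
  rewrite -(powR10_nat rho) -(powR_mulrn 2) ?powR_ge0 // -powRrM; apply: ler_powR; first by lra.
  by rewrite mulrC; exact: ltW.
have nat1 : (1000 * Num.truncn (2 * sg) <= N)%N.
  rewrite -(ler_nat R) [(1000 * _)%:R]natrM; move: r1 sgN sg0; clear.
  by move: sg (Num.truncn _) => z u; lra.
have nat2 : (300 <= N)%N by rewrite -(ler_nat R); move: sgN sg4; clear; lra.
have [q1 q2 q3] : [/\ 54 * rho <= mu, 17 * mu + 88 * rho <= 18 * nu & 2 * rho < nu]%N.
  move: hmu hnu nat1 nat2; rewrite /rho /N; clear; move: (Num.truncn _) => u.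
  by split; lia.
have hmuR : 333 * N%:R <= 1000 * mu%:R :> R by rewrite -!natrM ler_nat.
have sg1 : 1 <= sg by move: sg4; clear; lra.
have rho_le : rho%:R <= 2 * sg + 1 by rewrite rhoE lerD2r.
have small := uniform_bound_small th01 hmuR sg1 rho_le (ltn0Sn _).
have sup x := dprod_le (mu + 2 * rho) x th01 far.
have := type_two_le (ltn0Sn _ : (0 < rho)%N) q1 q2 q3 b1 sup small.
rewrite -/S -/N.
move=> B; have Sy0 : 0 <= S * y by rewrite mulr_ge0 // ltW.
have k0 : (0 : R) <= 60 * 10 ^+ 3 by rewrite mulr_ge0 ?exprn_ge0 ?ler0n.
have B0 : 0 <= 60 * 10 ^+ 3 * N%:R * 10 ^+ N :> R.
  by apply: mulr_ge0; [apply: mulr_ge0 k0 (ler0n _ _)|rewrite exprn_ge0].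
rewrite -(@ler_pXn2r _ 2) ?nnegrE // exprMn; apply: (@le_trans _ _ (S ^+ 2 * 10 ^+ rho)).
  by apply: ler_wpM2l => //; exact: sqr_ge0.
apply: (@le_trans _ _ (200 * N%:R ^+ 2 * (10 ^+ N) ^+ 2)).
  by rewrite -ler_pdivlMr // exprn_gt0.
rewrite !exprMn; apply: ler_wpM2r; first exact: sqr_ge0.
by apply: ler_wpM2r; [exact: sqr_ge0|lra].
Qed.

End TypeTwoSavings.

Theorem proposition1 (R : realType) :
  (forall (alpha : R) (mu nu : nat),
    9 * alpha \isn't a Num.int ->
    (0 < mu)%N -> (0 < nu)%N ->
    (4 - 2 * eps alpha) * xi alpha / eps alpha <= mu%:R / (mu + nu)%:R
      <= (1 - (6 - 2 * eps alpha) * xi alpha) / (2 - eps alpha) ->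
    1 / 3 - xi alpha / 4 <= mu%:R / (mu + nu)%:R ->
    forall b : nat -> R[i],
      (forall n : nat, (10 ^ nu.-1 < n <= 10 ^ nu)%N -> cabs (b n) <= 1) ->
      \sum_((10 ^ mu.-1).+1 <= m < (10 ^ mu).+1)
         cabs (\sum_((10 ^ nu.-1).+1 <= n < (10 ^ nu).+1)
                 b n * e (alpha * (digit_sum (m * n))%:R))
      <= C_II * (mu + nu)%:R
         * 10 `^ ((1 - c1 * dist_int (9 * alpha) ^+ 2) * (mu + nu)%:R))
  /\ (C_II : R) < 64 * 10 ^+ 3.
Proof.
have /andP[C1 C2] := C_II_bounds R; split => // alpha mu nu _ mu0 nu0 /andP[_ hi] lo b b1.
set th := dist_int (9 * alpha).
have th01 : 0 <= th <= 1 / 2 := dist_int_bounds (9 * alpha).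
have N0 : (0 < mu + nu)%N by rewrite addn_gt0 mu0.
set N := (mu + nu)%N in N0 lo hi *; have Np : (0 : R) < N%:R by rewrite ltr0n.
have /andP[e0 e1] := eps_bounds alpha; rewrite /xi in lo hi.
move: (eps alpha) e0 e1 lo hi => ep e0 e1 lo hi.
have h1 : (333 * N <= 1000 * mu)%N.
  rewrite -(ler_nat R) !natrM; move: lo; rewrite ler_pdivlMr //; nra.
have h2 : (90 * mu <= 91 * nu)%N.
  rewrite -(ler_nat R) !natrM.
  have : mu%:R / N%:R <= 91 / 181 :> R.
    by apply: (le_trans hi); rewrite ler_pdivrMr; [nra|lra].
  by rewrite ler_pdivrMr // /N natrD; lra.
apply: le_trans (type_two_savings th01 (fun k => dist_int_le (9 * alpha) k) N0 h1 h2 b1) _.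
apply: ler_pM; rewrite ?mulr_ge0 ?exprn_ge0 ?powR_ge0 //.
  by rewrite ler_pM2r.
apply: ler_powR; first by lra.
have z0 : 0 <= th ^+ 2 * N%:R by rewrite mulr_ge0 ?sqr_ge0.
have := ler_wpM2r z0 (c1_le R); rewrite -/N -/th; clear.
by move: (c1 : R) (th ^+ 2) (N%:R : R) => u v w; lra.
Qed.
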